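(* Let $I=[0,\gamma)$ with $0<\gamma\le\infty$ and let $w$ be a weight function on $I$. Let $\varphi$ and $\varphi_n$ ($n\ge1$) be Orlicz functions such that each $\varphi_n$ satisfies the $\Delta_\varphi(\infty)$-condition. Then the set $(\Lambda_{\varphi,w})_a\setminus\bigcup_{n=1}^\infty\Lambda_{\varphi_n,w}$ is $\mathfrak{c}$-spaceable in $(\Lambda_{\varphi,w})_a$. Moreover, if $\varphi$ satisfies the $\Delta_2$-condition when $\gamma=\infty$ (respectively, the $\Delta_2^\infty$-condition when $\gamma<\infty$), then $\Lambda_{\varphi,w}\setminus\bigcup_{n=1}^\infty\Lambda_{\varphi_n,w}$ is maximal-spaceable in $\Lambda_{\varphi,w}$.
   Context: The interval $I=[0,\gamma)$ carries Lebesgue measure $m$. $L_0$ is the space of real Lebesgue measurable functions on $I$ modulo a.e. equality. For $f\in L_0$, $d_f(\lambda)=m(\{t\in I:|f(t)|>\lambda\})$ for $\lambda>0$, and $f^*(t)=\inf\{\lambda>0:d_f(\lambda)\le t\}$ for $t\ge 0$ (with $\inf\varnothing=\infty$). An Orlicz function is a convex function $\varphi:[0,\infty)\to[0,\infty)$ with $\varphi(0)=0=\lim_{u\to0}\varphi(u)$ and $\varphi(u)>0$ for $u>0$ (put $\varphi(\infty)=\infty$). It satisfies the $\Delta_2^\infty$-condition if there are $K>2$, $u_0\ge0$ with $\varphi(2u)\le K\varphi(u)$ for all $u\ge u_0$; the $\Delta_2^0$-condition if there are $K>2$, $u_0>0$ with $\varphi(2u)\le K\varphi(u)$ for all $0\le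 u\le u_0$; the $\Delta_2$-condition if it satisfies both. An Orlicz function $\psi$ satisfies the $\Delta_\varphi(\infty)$-condition if for every $b>0$ there exists $u_0$ such that $\varphi(u)\le\psi(bu)$ for every $u\ge u_0$. A weight function on $I$ is a positive, decreasing (i.e. nonincreasing) function $w:I\setminus\{0\}\to(0,\infty)$ with $\int_0^t w<\infty$ for every $t\in I$; if $\gamma=\infty$ it is also assumed that $\int_0^\infty w=\infty$. The modular is $\rho_{\varphi,w}(f)=\int_I\varphi(f^*(t))w(t)\,dt$. The Orlicz-Lorentz space is $\Lambda_{\varphi,w}=\{f\in L_0:\rho_{\varphi,w}(kf)<\infty\text{ for some }k>0\}$ with the Luxemburg norm $\|f\|_{\varphi,w}=\inf\{\varepsilon>0:\rho_{\varphi,w}(f/\varepsilon)\le1\}$ (a Banach space). $(\Lambda_{\varphi,w})_a$ is its closed subspace of order-continuous elements (those $f$ with $\|f_n\|_{\varphi,w}\downarrow0$ whenever $|f_n|\le|f|$ and $|f_n|\downarrow0$ a.e.); it is well known that $(\Lambda_{\varphi,w})_a=\{f\in L_0:\rho_{\varphi,w}(kf)<\infty\text{ for every }k>0\}$. $\mathfrak{c}$ is the cardinality of the continuum; $\dim$ is algebraic dimension. A subset $A$ of a topological vector space $X$ is $\alpha$-spaceable in $X$ ($\alpha$ a cardinal) if there is a closed $\alpha$-dimensional vector subspace $M$ of $X$ with $M\subset A\cup\{0\}$; it is maximal-spaceable if it is $\dim(X)$-spaceable. *)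

(* Defs.v *)
From HB Require Import structures.
From mathcomp Require Import all_boot all_order all_algebra.
From mathcomp Require Import all_classical all_reals all_analysis.
From mathcomp Require Import measurable_realfun.

Set Implicit Arguments.
Unset Strict Implicit.
Unset Printing Implicit Defensive.

Import Order.TTheory GRing.Theory Num.Theory.
Import numFieldNormedType.Exports.

Local Open Scope classical_set_scope.
Local Open Scope ring_scope.
Local Open Scope quotient_scope.

(* The reals with the Lebesgue-measurable (Caratheodory) sigma-algebra; the
   library's [measurableTypeR R] only carries the Borel sets. *)
Definition lebR (R : realType) : measurableType _ :=
  @caratheodory_type R (ocitv_type R) ((wlength idfun)^*)%mu.

Definition leb (R : realType) : {measure set (lebR R) -> \bar R} :=
  @completed_lebesgue_measure R.

Section Interval.
Context {R : realType}.
Implicit Type gamma : \bar R.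

Definition intvl gamma : set R := [set t | 0 <= t /\ (t%:E < gamma)%E].

Definition intvl0 gamma : set R := intvl gamma `\ 0.

Lemma measurable_intvl gamma : measurable (intvl gamma : set (lebR R)).
Proof.
apply: sub_caratheodory.
have : measurable (intvl gamma : set (measurableTypeR R)); last by [].
case: gamma => [c||].
- rewrite (_ : intvl _ = `[0, c[%classic); first exact: measurable_itv.
  by apply/seteqP; split=> t /=; rewrite in_itv/= => /andP.
- rewrite (_ : intvl _ = `[0, +oo[%classic); first exact: measurable_itv.
  apply/seteqP; split=> t /=; rewrite in_itv/= andbT; first by case.
  by split=> //; rewrite ltry.
- rewrite (_ : intvl _ = set0); first exact: measurable0.
  by apply/seteqP; split=> t //= [_]; rewrite ltNge leNye.
Qed.

Definition lebI gamma : {measure set (lebR R) -> \bar R} :=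
  mrestr (@leb R) (measurable_intvl gamma).

(* Real Lebesgue measurable functions modulo equality a.e. on [0, gamma[.
   Representatives are defined on the whole line: their values off the interval
   are irrelevant, as [lebI] vanishes there. *)
Definition L0 gamma : Type := {mfun_ (lebI gamma), lebR R >-> R}.

HB.instance Definition _ gamma := Choice.on (L0 gamma).
HB.instance Definition _ gamma := EqQuotient.on (L0 gamma).

Definition L0_fun gamma (f : L0 gamma) : lebR R -> R := repr f.
Coercion L0_fun : L0 >-> Funclass.

End Interval.

Section L0Lmodule.
Context {R : realType} (gamma : \bar R).
Local Notation mf := {mfun lebR R >-> R}.
Local Notation L := (L0 gamma).
Implicit Types (u v : mf) (f g h : L) (a b : R).

Let pi_ae u v : u = v %[ae lebI gamma] -> \pi_L u = \pi_L v.
Proof. by move=> uv; apply/eqmodP/asboolP. Qed.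

Lemma L0_repr_pi u : repr (\pi_L u) = u %[ae lebI gamma].
Proof.
have /eqmodP : repr (\pi_L u) = u %[mod L] by rewrite reprK.
by move=> /asboolP.
Qed.

Lemma L0_piP f : exists u, f = \pi_L u.
Proof. by exists (repr f); rewrite reprK. Qed.

Definition L0_zero : L := \pi_L (0 : mf).
Definition L0_opp f : L := \pi_L (- repr f).
Definition L0_add f g : L := \pi_L (repr f + repr g).
Definition L0_scale a f : L := \pi_L (a *: repr f).

Lemma L0_oppE u : L0_opp (\pi_L u) = \pi_L (- u).
Proof.
apply: pi_ae; apply: filterS (L0_repr_pi u) => t E _ /=.
by rewrite [LHS]/(- repr (\pi_L u) t) E.
Qed.

Lemma L0_addE u v : L0_add (\pi_L u) (\pi_L v) = \pi_L (u + v).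
Proof.
apply: pi_ae; apply: filterS2 (L0_repr_pi u) (L0_repr_pi v) => t E F _ /=.
by rewrite [LHS]/(repr (\pi_L u) t + repr (\pi_L v) t) E // F.
Qed.

Lemma L0_scaleE a u : L0_scale a (\pi_L u) = \pi_L (a *: u).
Proof.
apply: pi_ae; apply: filterS (L0_repr_pi u) => t E _ /=.
by rewrite [LHS]/(a *: repr (\pi_L u) t) E.
Qed.

Lemma L0_addA : associative L0_add.
Proof.
by move=> f g h; case: (L0_piP f) => u ->; case: (L0_piP g) => v ->;
case: (L0_piP h) => z ->; rewrite !L0_addE addrA.
Qed.

Lemma L0_addC : commutative L0_add.
Proof.
by move=> f g; case: (L0_piP f) => u ->; case: (L0_piP g) => v ->;
rewrite !L0_addE addrC.
Qed.

Lemma L0_add0 : left_id L0_zero L0_add.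
Proof. by move=> f; case: (L0_piP f) => u ->; rewrite L0_addE add0r. Qed.

Lemma L0_addN : left_inverse L0_zero L0_opp L0_add.
Proof.
by move=> f; case: (L0_piP f) => u ->; rewrite L0_oppE L0_addE addNr.
Qed.

HB.instance Definition _ :=
  GRing.isZmodule.Build L L0_addA L0_addC L0_add0 L0_addN.

Lemma L0_scaleA a b f : L0_scale a (L0_scale b f) = L0_scale (a * b) f.
Proof. by case: (L0_piP f) => u ->; rewrite !L0_scaleE scalerA. Qed.

Lemma L0_scale1 : left_id 1 L0_scale.
Proof. by move=> f; case: (L0_piP f) => u ->; rewrite L0_scaleE scale1r. Qed.

Lemma L0_scaleDr : right_distributive L0_scale +%R.
Proof.
move=> a f g; case: (L0_piP f) => u ->; case: (L0_piP g) => v ->.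
by rewrite /+%R/= L0_addE !L0_scaleE L0_addE scalerDr.
Qed.

Lemma L0_scaleDl f : {morph L0_scale^~ f : a b / a + b}.
Proof.
move=> a b; case: (L0_piP f) => u ->; rewrite !L0_scaleE.
by rewrite [RHS]L0_addE scalerDl.
Qed.

HB.instance Definition _ := GRing.Zmodule_isLmodule.Build R L
  L0_scaleA L0_scale1 L0_scaleDr L0_scaleDl.

End L0Lmodule.

Section OrliczFunction.
Context {R : realType}.
Implicit Types phi psi : R -> R.

(* Only the restriction of [phi] to [0, +oo[ is meaningful. *)
Definition orlicz_function phi : Prop :=
  [/\ forall u, 0 <= u -> 0 <= phi u,
      @convex_function R R^o `[0, +oo[%classic phi,
      phi 0 = 0,
      phi u @[u --> 0^'+] --> 0 &
      forall u, 0 < u -> 0 < phi u].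

Definition delta2_infty phi : Prop :=
  exists K u0, [/\ 2 < K, 0 <= u0 &
    forall u, u0 <= u -> phi (2 * u) <= K * phi u].

Definition delta2_zero phi : Prop :=
  exists K u0, [/\ 2 < K, 0 < u0 &
    forall u, 0 <= u <= u0 -> phi (2 * u) <= K * phi u].

Definition delta2 phi : Prop := delta2_infty phi /\ delta2_zero phi.

(* [psi] satisfies the Delta_phi(oo)-condition. *)
Definition Delta_infty phi psi : Prop :=
  forall b, 0 < b -> exists u0, forall u, 0 <= u -> u0 <= u ->
    phi u <= psi (b * u).

End OrliczFunction.

(* Only the restriction of [w] to [intvl0 gamma] is meaningful. *)
Definition weight_function {R : realType} (gamma : \bar R) (w : R -> R) :
    Prop :=
  [/\ forall t, intvl0 gamma t -> 0 < w t,
      forall s t, intvl0 gamma s -> intvl0 gamma t -> s <= t -> w t <= w s,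
      forall t, intvl gamma t ->
        (\int[leb R]_(s in `]0%R, t]) (w s)%:E < +oo)%E &
      gamma = +oo%E -> (\int[leb R]_(s in `]0%R, +oo[) (w s)%:E = +oo)%E].

Section OrliczLorentz.
Context {R : realType} {gamma : \bar R}.
Implicit Types (phi w : R -> R) (f : L0 gamma).

Definition distribution_fun f (lambda : R) : \bar R :=
  leb R (intvl gamma `&` [set t : lebR R | lambda < `|f t|]).

Definition rearrangement f (t : R) : \bar R :=
  ereal_inf [set lambda%:E | lambda in
    [set l : R | 0 < l /\ (distribution_fun f l <= t%:E)%E]].

(* [er_map phi] extends [phi] by [phi +oo = +oo]. *)
Definition modular phi w f : \bar R :=
  (\int[leb R]_(t in intvl0 gamma)
     (er_map phi (rearrangement f t) * (w t)%:E))%E.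

Definition orlicz_lorentz phi w : set (L0 gamma) :=
  [set f | exists2 k : R, 0 < k & (modular phi w (k *: f) < +oo)%E].

Definition luxemburg_norm phi w f : \bar R :=
  ereal_inf [set e%:E | e in
    [set e : R | 0 < e /\ (modular phi w (e^-1 *: f) <= 1)%E]].

Definition order_continuous phi w : set (L0 gamma) :=
  [set f | orlicz_lorentz phi w f /\
    forall g : (L0 gamma)^nat,
      (forall n, \forall t \ae lebI gamma, `|g n t| <= `|f t|) ->
      (\forall t \ae lebI gamma, nonincreasing_seq (fun n => `|g n t|) /\
         (`|g n t| @[n --> \oo] --> 0)) ->
      nonincreasing_seq (fun n => luxemburg_norm phi w (g n)) /\
      (luxemburg_norm phi w (g n) @[n --> \oo] --> 0%E)].

End OrliczLorentz.

Section HamelBasis.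
Context {R : realType} {E : lmodType R}.
Implicit Types B V : set E.

Definition lin_independent B : Prop :=
  forall (s : seq E) (c : E -> R), uniq s -> (forall v, v \in s -> B v) ->
    \sum_(v <- s) c v *: v = 0 -> forall v, v \in s -> c v = 0.

Definition hamel_basis V B : Prop :=
  [/\ B `<=` V, lin_independent B &
      forall x, V x -> exists (s : seq E) (c : E -> R),
        (forall v, v \in s -> B v) /\ x = \sum_(v <- s) c v *: v].

(* Cardinals are represented by sets up to equipotence [#=]. *)
Definition has_dim {K : Type} V (alpha : set K) : Prop :=
  exists2 B, hamel_basis V B & (B #= alpha)%card.

End HamelBasis.

(* The normed space is a linear subspace [X] of [E] with the norm [N], which is
   only relevant on [X]. *)
Section Spaceability.
Context {R : realType} {E : lmodType R}.
Variables (X : set E) (N : E -> \bar R).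
Implicit Types A M : set E.

Definition norm_closure M : set E :=
  [set x | X x /\ forall e : R, 0 < e ->
    exists2 y, M y & (N (y - x) < e%:E)%E].

Definition closed_subspace M : Prop :=
  [/\ M `<=` X, submod_closed [in M] & norm_closure M `<=` M].

Definition spaceable {K : Type} (alpha : set K) A : Prop :=
  exists M, [/\ closed_subspace M, has_dim M alpha & M `<=` A `|` [set 0]].

Definition maximal_spaceable A : Prop :=
  exists2 B, hamel_basis X B & spaceable B A.

End Spaceability.

(* Main.v *)
Require Import Defs.
From HB Require Import structures.
From mathcomp Require Import all_boot all_order all_algebra.
From mathcomp Require Import all_classical all_reals all_analysis.
From mathcomp Require Import measurable_realfun ring lra.

Set Implicit Arguments.
Unset Strict Implicit.
Unset Printing Implicit Defensive.

Import Order.TTheory GRing.Theory Num.Theory.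
Import numFieldNormedType.Exports.

Local Open Scope classical_set_scope.
Local Open Scope ring_scope.

(** The idea is to build one function [F], a sum of peaks of height [u i] on
    disjoint sets [A i], which is barely small enough: its modular for [phi] is
    finite at every scale, whereas for every scale and every [n] the single
    peaks already have unbounded modulars for [phin n]. Such peaks exist
    because [phin n] eventually dominates all dilations of [phi]
    ([bump_exists], [peaks_exist]). The indices are distributed into infinitely
    many infinite groups; with [f_ k] the sum of the peaks of group [k], the
    subspace is the set [M] of all elements of the form [\sum_k a k * f_ k]
    ([combination]). A nonzero coefficient [a k] brings in infinitely many
    peaks, so that a nonzero element of [M] is in none of the spaces of the
    [phin n] ([combination_notin]); and [M] contains the combinations with
    bounded coefficients ([modular_combination_lty]).

    [M] is closed because convergence in the Luxemburg norm implies convergence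
    almost everywhere along a sequence ([norm_closure_ae]), and because being
    proportional to [u i] on the [A i] of a group and null elsewhere is
    preserved by limits almost everywhere ([combination_limit]).

    The dimension of [M] is that of the continuum: the combinations with
    geometric coefficients [k |-> z ^+ k], [0 < z < 1], are independent
    ([geometric_family]), and the whole of [L0] has no more elements than the
    reals ([card_L0_le]). The same two bounds apply to the Orlicz-Lorentz space
    itself, whose dimension is therefore also that of the continuum.

    All estimates of modulars rest on two facts about distribution functions.
    If the distribution of a function is at most the sum of the distributions
    [d_ i], its modular is at most [\sum_i 2 ^ i.+1 * rho_i], where [rho_i]
    is the modular associated with [d_ i] ([dmod_nneseries]); this replaces
    the triangle inequality and bounds the modular of [F]. If a function
    exceeds [c] on a set of measure [m], its modular is at least [phi c]
    times the integral of the weight over the interval from 0 to [m]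
    ([dmod_lower]). *)

(** * Hamel bases and the cardinal of the continuum *)

Section HamelExtension.
Context {R : realType} {E : lmodType R}.
Implicit Types (B V : set E) (s : seq E).

Lemma mem_span_of_dependent B x : lin_independent B -> ~ B x ->
  ~ lin_independent (B `|` [set x]) ->
  exists s (c : E -> R),
    (forall v, v \in s -> B v) /\ x = \sum_(v <- s) c v *: v.
Proof.
move=> indB Bx; apply: contra_notP => noB s c us sB s0.
have [xs|xs] := boolP (x \in s); last first.
  by apply: indB => // v vs; have [//|/= vx] := sB _ vs; rewrite -vx vs in xs.
have sxB v : v \in rem x s -> B v.
  by rewrite mem_rem_uniq// inE => /andP[/eqP vx /sB[]].
have cx0 : c x = 0.
  apply: contrapT => /eqP cx; apply: noB.
  exists (rem x s), (fun v => - (c x)^-1 * c v); split => //.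
  under eq_bigr do rewrite -scalerA.
  rewrite -scaler_sumr; move: s0; rewrite (big_rem x)//= => /eqP.
  by rewrite addrC addr_eq0 => /eqP ->;
    rewrite scalerN scaleNr opprK scalerA mulVf// scale1r.
move=> v vs; have [->//|vx] := eqVneq v x.
apply: (indB (rem x s)); rewrite ?rem_uniq//.
- by move: s0; rewrite (big_rem x)//= cx0 scale0r add0r.
- by rewrite mem_rem_uniq// inE vx.
Qed.

(** Zorn's lemma applies because a linear relation involves finitely many
    vectors, hence lives in a single member of a chain. *)
Lemma hamel_basis_extension B0 V : B0 `<=` V -> lin_independent B0 ->
  exists2 B, hamel_basis V B & B0 `<=` B.
Proof.
move=> B0V ind0.
pose P A := A `<=` V /\ lin_independent (B0 `|` A).
have [|A [[AV indA] maxA]] := @Zorn_bigcup _ P.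
  move=> F FP totF; split; first by apply: bigcup_sub => X /FP[].
  move=> s c us sF.
  suff [X [X0 sX]] : exists X, (X = set0 \/ F X) /\
      forall v, v \in s -> (B0 `|` X) v.
    have indX : lin_independent (B0 `|` X).
      by case: X0 => [->|/FP[]//]; rewrite setU0.
    exact: indX.
  elim: s {us} sF => [|v s IH] sF; first by exists set0; split; [left|].
  have [u us|X [X0 sX]] := IH; first by apply: sF; rewrite inE us orbT.
  have [Bv|[Y FY Yv]] := sF v (mem_head _ _).
    exists X; split => // u; rewrite inE => /orP[/eqP ->|/sX//]; by left.
  have [XY|YX] : X `<=` Y \/ Y `<=` X.
    by case: X0 => [->|FX]; [left; apply: sub0set|exact: totF].
  - exists Y; split; first by right.
    move=> u; rewrite inE => /orP[/eqP ->|/sX[]]; [by right|by left|].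
    by move=> /XY; right.
  - exists X; split => // u; rewrite inE => /orP[/eqP ->|/sX//].
    by right; apply: YX.
exists (B0 `|` A); last by move=> ? ?; left.
split => //; first by move=> v [/B0V|/AV].
move=> x Vx; have [Bx|Bx] := pselect ((B0 `|` A) x).
  exists [:: x], (fun=> 1); split; last by rewrite big_seq1 scale1r.
  by move=> v; rewrite inE => /eqP ->.
apply: mem_span_of_dependent => // indx.
apply: (maxA (A `|` [set x])).
  split; first by move=> v Av; left.
  by move=> /(_ x) Ax; apply: Bx; right; apply: Ax; right.
by split; [move=> v [/AV//|->]|rewrite setUA].
Qed.

End HamelExtension.

Section Continuum.
Context {R : realType}.

Let digits (b : nat -> bool) n : R := \sum_(k < n) (b k)%:R * 4^-1 ^+ k.

Let digits_tail b n m : (n <= m)%N ->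
  digits b m + 2 * 4^-1 ^+ m <= digits b n + 2 * 4^-1 ^+ n.
Proof.
move=> /subnK <-; elim: (m - n)%N => [|k]; first by rewrite add0n.
apply: le_trans; rewrite addSn /digits big_ord_recr /= -addrA lerD2l exprS.
have : 0 <= (4^-1 : R) ^+ (k + n) by rewrite exprn_ge0// invr_ge0.
by case: (b _) => /=; set u := _ ^+ _; lra.
Qed.

Let digits_mono b n m : (n <= m)%N -> digits b n <= digits b m.
Proof.
move=> /subnK <-; elim: (m - n)%N => // k /le_trans; apply.
rewrite addSn /digits big_ord_recr /= lerDl mulr_ge0 ?ler0n//.
Qed.

Let number b : R := sup (range (digits b)).

Let digits_sup b : has_sup (range (digits b)).
Proof.
split; first by exists (digits b 0%N), 0%N.
exists 2 => _ [n _ <-]; have := digits_tail b (leq0n n).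
rewrite {2}/digits big_ord0 expr0 mulr1 add0r; apply: le_trans.
by rewrite lerDl mulr_ge0// exprn_ge0// invr_ge0.
Qed.

(** With the digits 0 and 1 in base 4, all the digits that follow the first
    difference weigh less together than that difference. *)
Let number_lt (b b' : nat -> bool) n : (forall k, (k < n)%N -> b k = b' k) ->
  ~~ b n -> b' n -> number b < number b'.
Proof.
move=> bb' bn b'n; apply: (@lt_le_trans _ _ (digits b' n.+1)); last first.
  by apply: sup_upper_bound; [exact: digits_sup|exists n.+1].
have -> : digits b' n.+1 = digits b n.+1 + 4^-1 ^+ n.
  rewrite /digits !big_ord_recr /= b'n (negbTE bn) mul0r addr0 mul1r.
  by congr (_ + _); apply: eq_bigr => k _; rewrite bb'.
apply: (@le_lt_trans _ _ (digits b n.+1 + 2 * 4^-1 ^+ n.+1)); last first.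
  rewrite ltrD2l exprS; have : 0 < (4^-1 : R) ^+ n by rewrite exprn_gt0//
    invr_gt0.
  by set u := _ ^+ _; lra.
apply: ge_sup; first by case: (digits_sup b).
move=> _ [m _ <-]; have [nm|mn] := leqP n.+1 m.
  apply: le_trans (digits_tail b nm); rewrite lerDl mulr_ge0// exprn_ge0//.
apply: le_trans (digits_mono b (ltnW mn)) _.
by rewrite lerDl mulr_ge0// exprn_ge0// invr_ge0.
Qed.

Let number_inj : injective number.
Proof.
move=> b b' nbb'; apply/funext => n; apply: contrapT => /eqP bn.
have ex : exists n, b n != b' n by exists n.
have [m bm mmin] := ex_minnP ex => {n ex bn}.
have eqb k : (k < m)%N -> b k = b' k.
  by move=> km; apply/eqP; apply: contraTT km => /mmin; rewrite -leqNgt.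
have eqb' k : (k < m)%N -> b' k = b k by move=> /eqb.
case bmE : (b m) bm; case b'mE : (b' m) => //= _.
- by have := number_lt eqb' (negbT b'mE) bmE; rewrite nbb' ltxx.
- by have := number_lt eqb (negbT bmE) b'mE; rewrite nbb' ltxx.
Qed.

Lemma card_le_continuum (T : countType) (X : Type) (code : X -> T -> bool)
    (B : set X) : injective code -> (B #<= [set: R])%card.
Proof.
move=> codeI.
pose f x := number (fun n => oapp (code x) false (unpickle n)).
rewrite -(card_le_eql (@inj_card_eq _ _ B f _)) ?card_leT// => x y _ _.
move=> /number_inj xy; apply: codeI; apply/funext => t.
by have := congr1 (@^~ (pickle t)) xy; rewrite pickleK.
Qed.

End Continuum.

(** * Measurable functions modulo equality almost everywhere *)

Lemma measurable_leb {R : realType} (A : set R) :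
  measurable (A : set (measurableTypeR R)) -> measurable (A : set (lebR R)).
Proof. by move=> mA; apply: sub_caratheodory. Qed.

Lemma leb_lebesgue {R : realType} (A : set R) :
  leb R A = lebesgue_measure (A : set (measurableTypeR R)).
Proof. by []. Qed.

Section L0Theory.
Context {R : realType} {gamma : \bar R}.
Local Notation L := (L0 gamma).
Local Notation I := (intvl gamma : set (lebR R)).
Implicit Types f g h : L.
Local Open Scope quotient_scope.

Lemma measurable_L0 f : measurable_fun setT (f : lebR R -> R).
Proof. exact: measurable_funPT. Qed.

Lemma lebIE A : lebI gamma A = leb R (A `&` I).
Proof. by []. Qed.

Lemma aeI_P (P : lebR R -> Prop) : (\forall t \ae lebI gamma, P t) <->
  exists2 N : set (lebR R), measurable N /\ leb R N = 0 &
    forall t, I t -> ~ N t -> P t.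
Proof.
split=> [[N [mN N0 sN]]|[N [mN N0] NP]].
  exists (N `&` I); first by split=> //; exact/measurableI/measurable_intvl.
  move=> t It Nt; apply: contrapT => Pt; apply: Nt; split => //; exact: sN.
exists (~` I `|` N); split.
- by apply: measurableU => //; exact/measurableC/measurable_intvl.
- rewrite lebIE setIUl setICl set0U.
  apply: (subset_measure0 _ mN _ N0) => //; exact/measurableI/measurable_intvl.
- by move=> t; apply: contra_notP => /not_orP[/contrapT It Nt]; exact: NP.
Qed.

Lemma L0_eq f g : (\forall t \ae lebI gamma, f t = g t) -> f = g.
Proof.
move=> fg; rewrite -[f]reprK -[g]reprK; apply/eqmodP/asboolP.
by apply: filterS fg.
Qed.

Lemma L0_of_fun (u : lebR R -> R) : measurable_fun setT u ->
  exists f : L, \forall t \ae lebI gamma, f t = u t.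
Proof.
move=> mu; pose U : {mfun lebR R >-> R} :=
  HB.pack u (isMeasurableFun.Build _ _ _ _ u mu).
by exists (\pi_L U); apply: filterS (L0_repr_pi gamma U) => t; apply.
Qed.

Lemma L0_addE_ae f g : \forall t \ae lebI gamma, (f + g : L) t = f t + g t.
Proof.
by apply: filterS (L0_repr_pi gamma (repr f + repr g)) => t; apply.
Qed.

Lemma L0_scaleE_ae a f : \forall t \ae lebI gamma, (a *: f : L) t = a * f t.
Proof. by apply: filterS (L0_repr_pi gamma (a *: repr f)) => t; apply. Qed.

Lemma L0_zeroE_ae : \forall t \ae lebI gamma, (0 : L) t = 0.
Proof. by apply: filterS (L0_repr_pi gamma 0) => t; apply. Qed.

Lemma L0_oppE_ae f : \forall t \ae lebI gamma, (- f : L) t = - f t.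
Proof. by apply: filterS (L0_repr_pi gamma (- repr f)) => t; apply. Qed.

End L0Theory.

Section CardinalL0.
Context {R : realType}.

Definition Gdelta_of (e : nat -> nat -> R * R) : set (lebR R) :=
  \bigcap_n \bigcup_k `](e n k).1, (e n k).2]%classic.

(** [leb R] is an outer measure built on half-open intervals: the [n]-th
    level of the hull is a cover of [E] of total length at most [leb R E +
    n.+1%:R^-1]. *)
Lemma Gdelta_hull (E : set (lebR R)) : measurable E -> (leb R E < +oo)%E ->
  exists e, E `<=` Gdelta_of e /\ leb R (Gdelta_of e `\` E) = 0%E.
Proof.
move=> mE Eoo.
have inv0 n : 0 < n.+1%:R^-1 :> R by rewrite invr_gt0.
have cover n : exists A : nat -> R * R,
    E `<=` \bigcup_k `](A k).1, (A k).2]%classic /\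
    (\sum_(0 <= k <oo) leb R `](A k).1, (A k).2]%classic
      < leb R E + n.+1%:R^-1%:E)%E.
  have Efin : leb R E \is a fin_num by rewrite ge0_fin_numE.
  have [_ /= [A [mA EA] <-] ltA] := lb_ereal_inf_adherent (inv0 n) Efin.
  have /choice[e eA] k : exists x : R * R, A k = `]x.1, x.2]%classic.
    by have [x _ xA] := mA k; exists x.
  exists e; split; first by apply: subset_trans EA _ => t [k _ Ak]; exists k;
    rewrite -?eA.
  apply: le_lt_trans ltA; apply: lee_nneseries => // k _.
  rewrite -eA -((measurable_mu_extE (wlength idfun)) (A k))//.
have /choice[e eE] := cover; exists e; split.
  by move=> t Et n _; apply: (eE n).1.
apply/eqP; rewrite eq_le measure_ge0 andbT; apply/lee_addgt0Pr => _/posnumP[d].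
rewrite add0e; near \oo => n.
have mU : measurable (\bigcup_k `](e n k).1, (e n k).2]%classic : set (lebR R)).
  by apply: bigcupT_measurable => k; apply: measurable_leb;
    exact: measurable_itv.
have mG : measurable (Gdelta_of e).
  apply: bigcapT_measurable => m; apply: bigcupT_measurable => k.
  apply: measurable_leb; exact: measurable_itv.
set U := \bigcup_k _ in mU.
have UE : (leb R U <= leb R E + n.+1%:R^-1%:E)%E.
  apply: le_trans (ltW (eE n).2).
  exact: outer_measure_sigma_subadditive.
apply: (@le_trans _ _ (leb R (U `\` E))).
  apply: le_measure; rewrite ?inE//; [exact: measurableD|exact: measurableD|].
  by move=> t [Gt ?]; split => //; exact: Gt.
have -> : leb R (U `\` E) = (leb R U - leb R E)%E.
  rewrite measureD//; last by apply: le_lt_trans UE _;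
    rewrite lte_add_pinfty// ltry.
  by congr (_ - _)%E; congr (leb R _); apply/setIidPr; exact: (eE n).1.
rewrite leeBlDl ?ge0_fin_numE//; apply: le_trans UE _.
rewrite leeD2lE ?ge0_fin_numE// lee_fin ltW//.
by near: n; apply: near_infty_natSinv_lt.
Unshelve. all: by end_near. Qed.

Lemma eq_rat_cut (a b : R) : (forall p : rat, (ratr p < a) = (ratr p < b)) ->
  a = b.
Proof.
move=> ab; apply/eqP; rewrite eq_le !leNgt; apply/andP; split; apply/negP => lt.
- have [q] := rat_in_itvoo lt; rewrite in_itv /= => /andP[bq qa].
  by rewrite ab ltNge (ltW bq) in qa.
- have [q] := rat_in_itvoo lt; rewrite in_itv /= => /andP[bq qa].
  by rewrite -ab ltNge (ltW bq) in qa.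
Qed.

(** A measurable function is determined up to null sets by its superlevel
    sets above rational heights, cut into bounded pieces; each piece is
    determined up to a null set by a G-delta hull, and such a hull by
    countably many interval ends. *)
Lemma card_L0_le (gamma : \bar R) (B : set (L0 gamma)) :
  (B #<= [set: R])%card.
Proof.
pose J k : set (lebR R) := intvl gamma `&` `[- k%:R, k%:R]%classic.
pose E (f : L0 gamma) (q : rat) (k : nat) : set (lebR R) :=
  J k `&` [set t | ratr q < f t].
have mitv k : measurable (`[- k%:R, k%:R]%classic : set (lebR R)).
  by apply: measurable_leb; exact: measurable_itv.
have mJ k : measurable (J k) by apply: measurableI => //;
  exact: measurable_intvl.
have mE f q k : measurable (E f q k).
  apply: measurableI => //.
  rewrite -[X in measurable X]setTI.
  have -> : [set t | ratr q < f t] = f @^-1` `]ratr q, +oo[%classic.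
    by apply/seteqP; split=> t /=; rewrite in_itv /= andbT.
  by apply: measurable_L0 => //; exact: measurable_itv.
have Eoo f q k : (leb R (E f q k) < +oo)%E.
  apply: (@le_lt_trans _ _ (leb R `[- k%:R, k%:R]%classic)).
    by apply: le_measure; rewrite ?inE// => t [[]].
  by rewrite leb_lebesgue lebesgue_measure_itv; case: ifP => _; rewrite ltry.
have /choice[e eP] (x : L0 gamma * rat * nat) : exists e,
    E x.1.1 x.1.2 x.2 `<=` Gdelta_of e /\
    leb R (Gdelta_of e `\` E x.1.1 x.1.2 x.2) = 0%E.
  exact: Gdelta_hull.
pose code (f : L0 gamma) (x : rat * nat * nat * nat * bool * rat) : bool :=
  let: (q, k, n, i, s, p) := x in
  let r := e (f, q, k) n i in ratr p < if s then r.1 else r.2.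
apply: (@card_le_continuum _ _ _ code) => f g fg.
have efg q k : e (f, q, k) = e (g, q, k).
  apply/funext => n; apply/funext => i.
  have c s : (if s then (e (f, q, k) n i).1 else (e (f, q, k) n i).2) =
    (if s then (e (g, q, k) n i).1 else (e (g, q, k) n i).2).
    by apply: eq_rat_cut => p; exact: (congr1 (@^~ (q, k, n, i, s, p)) fg).
  by rewrite [LHS]surjective_pairing [RHS]surjective_pairing (c true) (c false).
have aeE q k : \forall t \ae lebI gamma, E f q k t <-> E g q k t.
  have [fG f0] := eP (f, q, k); have [gG g0] := eP (g, q, k).
  rewrite /= -efg in gG g0 fG f0; set G := Gdelta_of _ in fG f0 gG g0.
  have mG : measurable G.
    apply: bigcapT_measurable => m; apply: bigcupT_measurable => i.
    by apply: measurable_leb; exact: measurable_itv.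
  apply/aeI_P; exists ((G `\` E f q k) `|` (G `\` E g q k)).
    split; first by apply: measurableU; exact: measurableD.
    by apply: null_set_setU => //; exact: measurableD.
  move=> t _ Nt; split=> [ft|gt]; apply: contrapT => n; apply: Nt.
    by right; split => //; exact: fG.
  by left; split => //; exact: gG.
have {}aeE : \forall t \ae lebI gamma, forall n : nat,
    if unpickle n is Some (q, k) then E f q k t <-> E g q k t else True.
  apply: ae_foralln => n.
  by case: unpickle => [[q k]|]; [exact: aeE|apply: filterE].
apply: L0_eq; have : \forall t \ae lebI gamma, intvl gamma t.
  by apply/aeI_P; exists set0; rewrite ?measure0.
apply: filterS2 aeE => t aeE It.
have {}aeE q k : E f q k t <-> E g q k t by have := aeE (pickle (q, k));
  rewrite pickleK.
have [k tk] : exists k : nat, `|t| <= k%:R.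
  by exists (Num.truncn `|t|).+1; apply/ltW; rewrite truncnS_gt.
have Jt : J k t by split => //=; rewrite in_itv /= -ler_norml.
apply/esym/eq_rat_cut => q.
by apply/idP/idP => h; [have [] := (aeE q k).2|have [] := (aeE q k).1].
Qed.

End CardinalL0.

(** * Dilation of the variable *)

Section Dilation.
Context {R : realType}.
Local Open Scope ereal_scope.

Lemma measurable_fun_leb (D : set R) (f : R -> \bar R) :
  measurable (D : set (measurableTypeR R)) ->
  measurable_fun (D : set (measurableTypeR R)) f ->
  measurable_fun (D : set (lebR R)) (f : lebR R -> \bar R).
Proof. by move=> mD mf _ Y mY; apply: measurable_leb; exact: mf. Qed.

Lemma measurable_dilation (c : R) :
  measurable_fun [set: lebR R] (fun t : lebR R =>
    (c * t)%R : measurableTypeR R).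
Proof.
move=> _ Y mY; rewrite setTI; apply: measurable_leb.
have := @measurable_funM _ _ _ setT (cst c) (@idfun R) (measurable_cst c)
  (@measurable_id _ _ _).
by move=> /(_ measurableT Y mY); rewrite setTI.
Qed.

(** Both sides are measures on the Borel sets, and they agree on half-open
    intervals. *)
Lemma leb_dilation (c : R) (A : set (measurableTypeR R)) :
  (0 < c)%R -> measurable A ->
  leb R ((fun t => (c * t)%R) @^-1` A) = (c^-1)%:E * lebesgue_measure A.
Proof.
move=> c0 mA.
pose f (t : lebR R) : measurableTypeR R := (c * t)%R.
have mf : measurable_fun setT f by exact: measurable_dilation.
pose nu : {measure set (measurableTypeR R) -> \bar R} :=
  measure_function_pushforward__canonical__measure_function_Measure (leb R) mf.
pose mu : {measure set (measurableTypeR R) -> \bar R} :=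
  mscale (NngNum (ltW c0)) nu.
rewrite (@lebesgue_measure_unique _ mu) => [||//].
  by rewrite /mu /mscale /= muleA -EFinM mulVf ?gt_eqF// mul1e.
move=> X [[a b] _ <-].
have fE : f @^-1` `]a, b]%classic = `](c^-1 * a)%R, (c^-1 * b)%R]%classic.
  apply/seteqP; split=> t; rewrite /f /= !in_itv/= ![(c^-1 * _)%R]mulrC.
    by rewrite ltr_pdivrMr// ler_pdivlMr// [(c * t)%R]mulrC.
  by rewrite ltr_pdivrMr// ler_pdivlMr// [(c * t)%R]mulrC.
rewrite (_ : mu _ = c%:E * leb R `](c^-1 * a)%R, (c^-1 * b)%R]%classic);
  last first.
  by rewrite -fE.
rewrite leb_lebesgue [LHS]lebesgue_measure_itv /= [X in _ *
  X]lebesgue_measure_itv /=.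
rewrite !lte_fin ltr_pM2l ?invr_gt0//; case: ifPn => _; last by rewrite mule0.
by rewrite -EFinB -EFinM -mulrBr mulrA divff ?gt_eqF// mul1r.
Qed.

(** The identity map pushes the completed measure forward to the Borel one. *)
Lemma ge0_integral_leb (D : set R) (f : R -> \bar R) :
  measurable (D : set (measurableTypeR R)) ->
  measurable_fun (D : set (measurableTypeR R)) f ->
  (forall t, D t -> 0 <= f t) ->
  \int[leb R]_(t in (D : set (lebR R))) f t =
  \int[lebesgue_measure]_(t in (D : set (measurableTypeR R))) f t.
Proof.
move=> mD mf f0.
have mid : measurable_fun setT (idfun : lebR R -> measurableTypeR R).
  by move=> _ Y mY; rewrite setTI; exact: measurable_leb.
rewrite -(@ge0_integral_pushforward _ _ _ _ R _ mid (leb R) D f)//.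
by move=> t /set_mem/f0.
Qed.

Lemma ge0_integral_dilation (c : R) (D : set R) (f : R -> \bar R) :
  (0 < c)%R ->
  measurable (D : set (measurableTypeR R)) ->
  measurable_fun (D : set (measurableTypeR R)) f ->
  (forall t, D t -> 0 <= f t) ->
  \int[leb R]_(t in (fun t : lebR R => c * t)%R @^-1` D) f (c * t)%R =
  (c^-1)%:E * \int[leb R]_(t in (D : set (lebR R))) f t.
Proof.
move=> c0 mD mf f0; rewrite [in RHS]ge0_integral_leb//.
pose g (t : lebR R) : measurableTypeR R := (c * t)%R.
have mg : measurable_fun setT g by exact: measurable_dilation.
transitivity (\int[pushforward (leb R) g]_(t in D) f t).
  by rewrite (ge0_integral_pushforward mg)// => t /set_mem/f0.
have c0' : (0 <= c^-1)%R by rewrite invr_ge0 ltW.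
rewrite -(@ge0_integral_mscale _ _ _ lebesgue_measure D mD (NngNum c0'))//.
apply: (@eq_measure_integral _ _ _ _ (mscale (NngNum c0') lebesgue_measure)
  (measure_function_pushforward__canonical__measure_function_Measure (leb R)
    mg)) => A mA _.
exact: leb_dilation.
Qed.

End Dilation.

(** * Orlicz functions *)

Section Orlicz.
Context {R : realType}.
Variable phi : R -> R.
Hypothesis phiO : orlicz_function phi.
Implicit Types (a b c s u v : R) (x y : \bar R).

Lemma orlicz_ge0 u : 0 <= u -> 0 <= phi u.
Proof. by case: phiO => + _ _ _ _; apply. Qed.

Lemma orlicz0 : phi 0 = 0.
Proof. by case: phiO. Qed.

Lemma orlicz_gt0 u : 0 < u -> 0 < phi u.
Proof. by case: phiO => _ _ _ _; apply. Qed.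

Lemma orlicz_convex s u v : 0 <= s -> s <= 1 -> 0 <= u -> 0 <= v ->
  phi (s * u + (1 - s) * v) <= s * phi u + (1 - s) * phi v.
Proof.
move=> s0 s1 u0 v0.
case: phiO => _ + _ _ _ => /(_ (Itv01 s0 s1) u v);
  rewrite !inE /= !in_itv /= u0 v0.
by move=> /(_ isT isT).
Qed.

Lemma orlicz_shrink s u : 0 <= s -> s <= 1 -> 0 <= u ->
  phi (s * u) <= s * phi u.
Proof.
move=> s0 s1 u0; have := orlicz_convex s0 s1 u0 (lexx 0).
by rewrite orlicz0 !mulr0 !addr0.
Qed.

Lemma orlicz_expand c u : 1 <= c -> 0 <= u -> c * phi u <= phi (c * u).
Proof.
move=> c1 u0; have c0 : 0 < c by apply: lt_le_trans c1.
have := @orlicz_shrink c^-1 (c * u).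
rewrite invr_ge0 invf_le1// (ltW c0) c1 mulr_ge0 ?(ltW c0)// mulKf ?gt_eqF//.
by move=> /(_ isT isT isT); rewrite ler_pdivlMl.
Qed.

Lemma orlicz_le u v : 0 <= u -> u <= v -> phi u <= phi v.
Proof.
move=> u0; rewrite le_eqVlt => /predU1P[->//|uv].
have v0 : 0 < v by apply: le_lt_trans uv.
have := @orlicz_shrink (u / v) v; rewrite divfK ?gt_eqF//.
rewrite divr_ge0 ?(ltW v0)// ler_pdivrMr// mul1r (ltW uv) => /(_ isT isT isT).
by move=> /le_trans; apply; rewrite ler_piMl ?orlicz_ge0 ?(ltW v0)//
  ler_pdivrMr// mul1r ltW.
Qed.

(** Convexity makes [phi] left-continuous, here in the form of a bound: [a]
    lies between [c] and [2 a], and [c] can be taken close to [a]. *)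
Lemma orlicz_left a b : 0 < a -> (forall c, 0 <= c < a -> phi c <= b) ->
  phi a <= b.
Proof.
move=> a0 ub; rewrite leNgt; apply/negP => lt.
have b0 : 0 <= b by rewrite -orlicz0; apply: ub; rewrite lexx.
have a20 : 0 < phi (2 * a) by apply: orlicz_gt0; rewrite mulr_gt0.
pose e := phi a - b; have e0 : 0 < e by rewrite subr_gt0.
(* The weight of [2 * a]: small enough for [s * phi (2 * a) < e]. *)
pose s := e / (4 * (phi (2 * a) + e)).
have d0 : 0 < phi (2 * a) + e by rewrite addr_gt0.
have s0 : 0 < s by rewrite divr_gt0// mulr_gt0.
have sE : s * (4 * (phi (2 * a) + e)) = e by rewrite /s divfK// gt_eqF//
  mulr_gt0.
have s14 : s <= 4^-1.
  by rewrite /s ler_pdivrMr ?mulr_gt0// mulrA mulVf// mul1r lerDr ltW.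
pose c := a * (1 - 2 * s) / (1 - s).
have s1 : 0 < 1 - s by lra.
have c0 : 0 <= c by rewrite divr_ge0 ?(ltW s1)// mulr_ge0 ?(ltW a0)//; lra.
have ca : c < a by rewrite /c ltr_pdivrMr// ltr_pM2l//; lra.
have aE : a = s * (2 * a) + (1 - s) * c.
  by rewrite /c mulrC [X in _ + X]mulrC divfK ?gt_eqF//; lra.
have h : phi a <= s * phi (2 * a) + (1 - s) * phi c.
  by rewrite {1}aE; apply: orlicz_convex => //; [exact: ltW|lra|lra].
have cb : phi c <= b by apply: ub; rewrite c0 ca.
have : (1 - s) * phi c <= (1 - s) * b by rewrite ler_wpM2l// ltW.
have : 0 <= s * b by rewrite mulr_ge0// ltW.
have : 0 < s * e by rewrite mulr_gt0.
by rewrite mulrDr in sE; rewrite /e in h sE *; nra.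
Qed.

Local Open Scope ereal_scope.

Lemma er_map_ge0 x : 0 <= x -> 0 <= er_map phi x.
Proof. by case: x => [u||]//=; rewrite !lee_fin => /orlicz_ge0. Qed.

Lemma er_map_le x y : 0 <= x -> x <= y -> er_map phi x <= er_map phi y.
Proof.
case: x y => [u||] [v||]//=; rewrite ?leey// !lee_fin.
exact: orlicz_le.
Qed.

(** Left-continuity in the form needed for rearrangements, which are
    controlled only through the levels strictly below them. *)
Lemma er_map_lub x y : 0 <= x ->
  (forall c : R, (0 <= c)%R -> c%:E < x -> (phi c)%:E <= y) -> 0 <= y ->
  er_map phi x <= y.
Proof.
case: x => [a||]//=; rewrite ?lee_fin.
- rewrite le_eqVlt => /predU1P[<-|a0]; first by rewrite orlicz0.
  case: y => [b||] ub y0 //; last by rewrite leey.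
  rewrite lee_fin; apply: orlicz_left => // c /andP[c0 ca].
  by rewrite -lee_fin ub.
- case: y => [b||]// _ ub b0.
  have p1 := orlicz_gt0 ltr01.
  pose c : R := (1 + (`|b| + 1) / phi 1)%R.
  have c1 : (1 <= c)%R by rewrite lerDl divr_ge0 ?(ltW p1)// addr_ge0.
  have := ub c (le_trans ler01 c1) (ltry _); rewrite lee_fin.
  have := orlicz_expand c1 ler01; rewrite mulr1 /c mulrDl divfK ?gt_eqF//.
  move=> /le_trans /[apply]; move: b0; rewrite lee_fin => b0.
  by rewrite ger0_norm// => h; exfalso; clear ub; lra.
Qed.

End Orlicz.

(** * Rearrangement and modular of a distribution function *)

Section Rearrangement.
Context {R : realType}.
Local Open Scope ereal_scope.
Implicit Types (d : R -> \bar R) (l t : R).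

(** Rearrangements and modulars are handled on the side of distribution
    functions, where a countable sum of functions with disjoint supports
    becomes a plain sum. *)
Definition rearr d t : \bar R :=
  ereal_inf [set l%:E | l in [set l : R | (0 < l)%R /\ d l <= t%:E]].

Lemma rearr_ge d t x :
  (forall l, (0 < l)%R -> d l <= t%:E -> x <= l%:E) -> x <= rearr d t.
Proof. by move=> xl; apply: le_ereal_inf_tmp => _ [l [l0 dl] <-];
  exact: xl. Qed.

Lemma rearr_ge0 d t : 0 <= rearr d t.
Proof. by apply: rearr_ge => l l0 _; rewrite lee_fin ltW. Qed.

Lemma rearr_le d t l : (0 < l)%R -> d l <= t%:E -> rearr d t <= l%:E.
Proof. by move=> l0 dl; apply: ereal_inf_lbound; exists l. Qed.

Lemma rearr_ltP d t x : rearr d t < x ->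
  exists2 l, (0 < l)%R /\ d l <= t%:E & l%:E < x.
Proof. by move=> /ereal_inf_lt[_ [l dl <-] lx]; exists l. Qed.

Lemma le_rearr d d' t : (forall l, (0 < l)%R -> d l <= d' l) ->
  rearr d t <= rearr d' t.
Proof.
by move=> dd'; apply: rearr_ge => l l0 dl; apply: rearr_le => //;
  apply: le_trans dl; exact: dd'.
Qed.

Lemma rearr_nonincr d s t : (s <= t)%R -> rearr d t <= rearr d s.
Proof.
move=> st; apply: rearr_ge => l l0 dl; apply: rearr_le => //.
by apply: le_trans dl _; rewrite lee_fin.
Qed.

Lemma measurable_nonincr (D : set R) (f : R -> \bar R) : is_interval D ->
  (forall s t, D s -> D t -> (s <= t)%R -> f t <= f s) ->
  measurable_fun (D : set (measurableTypeR R)) f.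
Proof.
move=> iD fD; apply: (measurability _ (ErealGenOInfty.measurableE R)) =>
  /= _ [_ [r ->] <-].
apply: is_interval_measurable => s t /= [Ds fs] [Dt ft] u sut.
have Du : D u by exact: iD sut.
split => //=; move: fs ft; rewrite !in_itv/= !andbT => fs ft.
by apply: lt_le_trans ft _; apply: fD => //; case/andP: sut.
Qed.

End Rearrangement.

Section Modular.
Context {R : realType} {gamma : \bar R}.
Variables (w phi : R -> R).
Hypothesis gamma0 : (0 < gamma)%E.
Hypothesis wP : weight_function gamma w.
Hypothesis phiO : orlicz_function phi.
Local Notation D := (@intvl0 R gamma).
Local Open Scope ereal_scope.
Implicit Types (d : R -> \bar R) (l t u m c : R).

Lemma intvl0P t : D t <-> (0 < t)%R /\ t%:E < gamma.
Proof.
split=> [[[t0 tg] /eqP tn0]|[t0 tg]].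
  by split=> //; rewrite lt_neqAle eq_sym tn0.
by split; [split => //; exact: ltW|apply/eqP; rewrite gt_eqF].
Qed.

Lemma is_interval_intvl0 : is_interval D.
Proof.
move=> s t /intvl0P[s0 sg] /intvl0P[t0 tg] u /andP[su ut]; apply/intvl0P; split.
  exact: lt_le_trans su.
by apply: le_lt_trans tg; rewrite lee_fin.
Qed.

Lemma measurable_intvl0 : measurable (D : set (measurableTypeR R)).
Proof. exact: is_interval_measurable is_interval_intvl0. Qed.

Lemma measurable_intvl0_leb : measurable (D : set (lebR R)).
Proof. by apply: measurable_leb; exact: measurable_intvl0. Qed.

Lemma weight_ge0 t : D t -> 0 <= (w t)%:E.
Proof. by move=> Dt; rewrite lee_fin; case: wP => /(_ _ Dt)/ltW. Qed.

Lemma weight_nonincr s t : D s -> D t -> (s <= t)%R -> (w t <= w s)%R.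
Proof. by case: wP => _ + _ _; apply. Qed.

Definition integrand d t : \bar R := er_map phi (rearr d t) * (w t)%:E.

Definition dmod d : \bar R := \int[leb R]_(t in D) integrand d t.

Lemma modularE (f : L0 gamma) : modular phi w f = dmod (distribution_fun f).
Proof. by []. Qed.

Lemma integrand_ge0 d t : D t -> 0 <= integrand d t.
Proof.
by move=> Dt; rewrite mule_ge0 ?weight_ge0//; exact/er_map_ge0/rearr_ge0.
Qed.

Lemma le_integrand d d' s t : D s -> D t -> (s <= t)%R ->
  (forall l, (0 < l)%R -> d l <= d' l) -> integrand d t <= integrand d' s.
Proof.
move=> Ds Dt st dd'; apply: lee_pmul.
- exact/er_map_ge0/rearr_ge0.
- exact: weight_ge0.
- apply: er_map_le => //; first exact: rearr_ge0.
  by apply: le_trans (le_rearr _ dd') _; exact: rearr_nonincr.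
- by rewrite lee_fin; exact: weight_nonincr.
Qed.

Lemma measurable_integrand d :
  measurable_fun (D : set (measurableTypeR R)) (integrand d).
Proof.
apply: measurable_nonincr is_interval_intvl0 _ => s t Ds Dt st.
exact: le_integrand.
Qed.

Lemma measurable_integrand_leb d :
  measurable_fun (D : set (lebR R)) (integrand d).
Proof.
by apply: measurable_fun_leb; [exact: measurable_intvl0|exact:
  measurable_integrand].
Qed.

Lemma dmod_ge0 d : 0 <= dmod d.
Proof. by apply: integral_ge0 => t; exact: integrand_ge0. Qed.

Lemma le_dmod d d' : (forall l, (0 < l)%R -> d l <= d' l) -> dmod d <= dmod d'.
Proof.
move=> dd'; apply: ge0_le_integral.
- exact: measurable_intvl0_leb.
- by move=> t; exact: integrand_ge0.
- exact: measurable_integrand_leb.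
- exact: measurable_integrand_leb.
- by move=> t Dt; exact: le_integrand.
Qed.

Lemma nneseries_ge_term (u_ : nat -> \bar R) n : (forall k, 0 <= u_ k) ->
  u_ n <= \sum_(k <oo) u_ k.
Proof.
move=> u0; rewrite (nneseriesD1 (n := n))//.
by rewrite leeDl// nneseries_ge0.
Qed.

(** If each [d_ i l] is at most [t / 2 ^ i.+1] then [d l <= t]; hence the
    rearrangement of [d] at [t] is dominated by those of the [d_ i] at [t / 2
    ^ i.+1]. As [w] decreases, the dilation of the variable only costs the
    factor [2 ^ i.+1]. *)
Lemma dmod_nneseries d (d_ : nat -> R -> \bar R) :
  (forall i l, 0 <= d_ i l) ->
  (forall i l l', (l <= l')%R -> d_ i l' <= d_ i l) ->
  (forall l, (0 < l)%R -> d l <= \sum_(i <oo) d_ i l) ->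
  dmod d <= \sum_(i <oo) (2 ^ i.+1)%:R%:E * dmod (d_ i).
Proof.
move=> d0 d_ni dd_.
pose c i : R := ((2 ^ i.+1)%:R^-1)%R.
have c0 i : (0 < c i)%R by rewrite invr_gt0 ltr0n expn_gt0.
have c1 i : (c i <= 1)%R by rewrite invf_le1 ?ler1n ?ltr0n expn_gt0.
have Dc i t : D t -> D (c i * t)%R.
  move=> /intvl0P[t0 tg]; apply/intvl0P; split; first by rewrite mulr_gt0.
  by apply: le_lt_trans tg; rewrite lee_fin ler_piMl// ltW.
have cle i t : D t -> (c i * t <= t)%R.
  by move=> /intvl0P[t0 _]; rewrite ler_piMl// ltW.
have key t : D t -> integrand d t <= \sum_(i <oo) integrand (d_ i) (c i * t)%R.
  move=> Dt; have [t0 _] := (intvl0P t).1 Dt.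
  pose x i := er_map phi (rearr (d_ i) (c i * t)%R).
  have x0 i : 0 <= x i by exact/er_map_ge0/rearr_ge0.
  have : er_map phi (rearr d t) <= \sum_(i <oo) x i.
    apply: er_map_lub; rewrite ?rearr_ge0 ?nneseries_ge0// => l l0 lt.
    have [i li] : exists i, l%:E <= rearr (d_ i) (c i * t)%R.
      move: l0; rewrite le_eqVlt => /predU1P[<-|l0]; first by exists 0%N;
        exact: rearr_ge0.
      apply: contrapT => /forallNP h; move: lt; apply/negP; rewrite -leNgt.
      apply: rearr_le => //; apply: le_trans (dd_ _ l0) _.
      apply: le_trans (epsilon_trick0 xpredT (ltW t0));
        apply: lee_nneseries => // i _.
      have /negP := h i; rewrite -ltNge => /rearr_ltP[l' [_ dl'] l'l].
      rewrite [X in _ <= X%:E]mulrC; apply: le_trans dl'.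
      by apply: d_ni; rewrite -lee_fin ltW.
    apply: le_trans (nneseries_ge_term i x0).
    exact: (er_map_le phiO _ li).
  move=> h; rewrite /integrand muleC;
    apply: le_trans (lee_wpmul2l (weight_ge0 Dt) h) _.
  rewrite -nneseriesZl//; apply: lee_nneseries => [i _ _|i _].
    by rewrite mule_ge0// weight_ge0.
  rewrite muleC; apply: lee_wpmul2l => //; rewrite lee_fin weight_nonincr//;
    [exact: Dc|exact: cle].
have m_c i E : is_interval E -> E `<=` (fun t => c i * t)%R @^-1` D ->
    measurable_fun (E : set (measurableTypeR R)) (fun t =>
      integrand (d_ i) (c i * t)%R).
  move=> iE EDc; apply: measurable_nonincr iE _ => s t Ds Dt st.
  by apply: le_integrand; [exact: EDc|exact: EDc|rewrite ler_pM2l|].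
have iDc i : is_interval ((fun t => c i * t)%R @^-1` D).
  move=> s t Ds Dt u /andP[su ut]; apply: is_interval_intvl0 Ds Dt _ _.
  by rewrite !ler_pM2l// su ut.
apply: (@le_trans _ _ (\int[leb R]_(t in D) \sum_(i <oo) integrand (d_ i) (c i
  * t)%R)).
  apply: ge0_le_integral.
  - exact: measurable_intvl0_leb.
  - by move=> t; exact: integrand_ge0.
  - exact: measurable_integrand_leb.
  - apply: ge0_emeasurable_sum => [i t Dt _|i _]; first exact/integrand_ge0/Dc.
    apply: measurable_fun_leb; first exact: measurable_intvl0.
    by apply: m_c => [|t]; [exact: is_interval_intvl0|exact: Dc].
  - exact: key.
rewrite integral_nneseries; last 3 first.
  - exact: measurable_intvl0_leb.
  - move=> i; apply: measurable_fun_leb; first exact: measurable_intvl0.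
    by apply: m_c => [|t]; [exact: is_interval_intvl0|exact: Dc].
  - by move=> i t Dt; exact/integrand_ge0/Dc.
apply: lee_nneseries => [i _ _|i _].
  by apply: integral_ge0 => t Dt; exact/integrand_ge0/Dc.
have -> : (2 ^ i.+1)%:R = ((c i)^-1)%R by rewrite /c invrK.
rewrite -(@ge0_integral_dilation _ (c i) D)//; last 3 first.
  - exact: measurable_intvl0.
  - exact: measurable_integrand.
  - by move=> t; exact: integrand_ge0.
have mDc : measurable ((fun t => c i * t)%R @^-1` D : set (measurableTypeR R)).
  exact: is_interval_measurable.
apply: ge0_subset_integral.
- exact: measurable_intvl0_leb.
- exact: measurable_leb.
- by apply: measurable_fun_leb => //; exact: m_c.
- by move=> t; exact: integrand_ge0.
- by move=> t; exact: Dc.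
Qed.

End Modular.

(** * Bounds for the modular by the mass of the weight near the origin *)

Section WeightMass.
Context {R : realType} {gamma : \bar R}.
Variables (w phi : R -> R).
Hypothesis gamma0 : (0 < gamma)%E.
Hypothesis wP : weight_function gamma w.
Hypothesis phiO : orlicz_function phi.
Local Notation D := (@intvl0 R gamma).
Local Open Scope ereal_scope.
Implicit Types (d : R -> \bar R) (l t u c : R) (m : \bar R).

Definition below m : set R := D `&` [set t | t%:E < m].

Lemma is_interval_below m : is_interval (below m).
Proof.
move=> s t [Ds sm] [Dt tm] u sut; split;
  first exact: (is_interval_intvl0 Ds Dt).
by apply: le_lt_trans tm; rewrite lee_fin; case/andP: sut.
Qed.

Lemma measurable_below m : measurable (below m : set (lebR R)).
Proof.
by apply: measurable_leb; apply: is_interval_measurable;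
  exact: is_interval_below.
Qed.

Lemma measurable_weight (E : set R) : is_interval E -> E `<=` D ->
  measurable_fun (E : set (lebR R)) (fun t => (w t)%:E).
Proof.
move=> iE ED; apply: measurable_fun_leb; first exact: is_interval_measurable.
apply: measurable_nonincr iE _ => s t Es Et st; rewrite lee_fin.
by apply: (weight_nonincr wP) => //; exact: ED.
Qed.

Definition weight_mass m : \bar R := \int[leb R]_(t in below m) (w t)%:E.

(** On [below m] the rearrangement of [d] is at least [c]. *)
Lemma dmod_lower d c m : (0 <= c)%R -> (forall l, (0 < l < c)%R -> m <= d l) ->
  (phi c)%:E * weight_mass m <= dmod (gamma := gamma) w phi d.
Proof.
move=> c0 md.
have wge0 t : below m t -> 0 <= (w t)%:E by move=> [Dt _];
  exact: (weight_ge0 wP Dt).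
rewrite /weight_mass -ge0_integralZl_EFin; last 4 first.
- exact: measurable_below.
- exact: wge0.
- by apply: measurable_weight => [|t []//]; exact: is_interval_below.
- exact: orlicz_ge0.
have mint : measurable_fun (below m : set (lebR R)) (integrand w phi d).
  apply: measurable_funS (measurable_integrand_leb wP phiO d) => [|t []//].
  exact: measurable_intvl0_leb.
apply: (@le_trans _ _ (\int[leb R]_(t in below m) integrand w phi d t)).
  apply: ge0_le_integral.
  - exact: measurable_below.
  - move=> t bt; apply: mule_ge0; [exact: (orlicz_ge0 phiO)|exact: wge0].
  - apply: measurable_funeM.
    by apply: measurable_weight => [|t []//]; exact: is_interval_below.
  - exact: mint.
  - move=> t [Dt tm]; rewrite /integrand; apply: lee_wpmul2r.
      exact: (weight_ge0 wP Dt).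
    apply: (@er_map_le _ _ phiO c%:E); first by rewrite lee_fin.
    apply: rearr_ge => l l0 dl; rewrite lee_fin leNgt; apply/negP => lc.
    have := md l; rewrite l0 lc => /(_ isT) /le_trans /(_ dl).
    by rewrite leNgt tm.
apply: ge0_subset_integral.
- exact: measurable_below.
- exact: measurable_intvl0_leb.
- exact: measurable_integrand_leb.
- by move=> t; exact: integrand_ge0.
- by move=> t [].
Qed.

(** The rearrangement of [d] is at most [u], and it vanishes from [m] on. *)
Lemma dmod_block_upper d u m : (0 < u)%R ->
  (forall l, (0 < l)%R -> d l <= if (l < u)%R then m else 0) ->
  dmod (gamma := gamma) w phi d <= (phi u)%:E * weight_mass m.
Proof.
move=> u0 dm.
have wge0 t : below m t -> 0 <= (w t)%:E by move=> [Dt _];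
  exact: (weight_ge0 wP Dt).
have mw : measurable_fun (below m : set (lebR R)) (fun t => (w t)%:E).
  by apply: measurable_weight => [|t []//]; exact: is_interval_below.
have pu : (0 <= phi u)%R by apply: orlicz_ge0 => //; exact: ltW.
rewrite /weight_mass -ge0_integralZl_EFin; last 4 first.
- exact: measurable_below.
- exact: wge0.
- exact: mw.
- exact: pu.
have -> : \int[leb R]_(t in below m) ((phi u)%:E * (w t)%:E) =
    \int[leb R]_(t in D) ((fun t => (phi u)%:E * (w t)%:E) \_ [set t | t%:E <
      m]) t.
  exact: integral_mkcondr.
apply: ge0_le_integral.
- exact: measurable_intvl0_leb.
- by move=> t; exact: integrand_ge0.
- exact: measurable_integrand_leb.
- apply/(@measurable_restrict _ _ _ _ [set t : lebR R | t%:E < m] D).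
  + apply: measurable_leb; apply: is_interval_measurable =>
    s t /= _ tm v /andP[_ vt] /=.
    by apply: le_lt_trans tm; rewrite lee_fin.
  + exact: measurable_intvl0_leb.
  + exact: measurable_funeM.
move=> t Dt; have [t0 _] := (intvl0P t).1 Dt; rewrite /patch; case: ifPn => tm.
  rewrite /integrand; apply: lee_wpmul2r; first exact: (weight_ge0 wP Dt).
  apply: (@er_map_le _ _ phiO _ u%:E); first exact: rearr_ge0.
  apply: rearr_le => //; apply: le_trans (dm _ u0) _.
  by rewrite ltxx lee_fin ltW.
have {}tm : m <= t%:E by move: tm; rewrite notin_setE /= => /negP;
  rewrite -leNgt.
rewrite /integrand (_ : rearr d t = 0) /= ?(orlicz0 phiO) ?mul0e//.
apply/eqP; rewrite eq_le rearr_ge0 andbT; apply/lee_addgt0Pr => e e0.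
rewrite add0e; apply: rearr_le => //; apply: le_trans (dm _ e0) _.
by case: ifP => // _; rewrite lee_fin ltW.
Qed.

Lemma weight_mass_gt0 m : 0 < m -> 0 < weight_mass m.
Proof.
move=> m0.
have [t [t0 tm tg]] : exists t, [/\ (0 < t)%R, t%:E < m & t%:E < gamma].
  have : 0 < mine m gamma by rewrite lt_min m0 gamma0.
  case mgE : (mine m gamma) => [r||] //.
  - rewrite lte_fin => r0; exists (r / 2)%R; split; first by rewrite divr_gt0.
    + apply: (@lt_le_trans _ _ r%:E);
      first by rewrite lte_fin ltr_pdivrMr// ltr_pMr// ltr1n.
      by rewrite -mgE ge_min lexx.
    + apply: (@lt_le_trans _ _ r%:E);
      first by rewrite lte_fin ltr_pdivrMr// ltr_pMr// ltr1n.
      by rewrite -mgE ge_min lexx orbT.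
  - move=> _; exists 1%R; split => //.
    + by apply: (@lt_le_trans _ _ +oo); rewrite ?ltry// -mgE ge_min lexx.
    + by apply: (@lt_le_trans _ _ +oo); rewrite ?ltry// -mgE ge_min lexx orbT.
have Dt : D t by apply/intvl0P.
have sub : `]0%R, t]%classic `<=` below m.
  move=> s; rewrite /= in_itv/= => /andP[s0 st]; split.
    by apply/intvl0P; split => //; apply: le_lt_trans tg; rewrite lee_fin.
  by apply: le_lt_trans tm; rewrite lee_fin.
have mt : measurable (`]0%R, t]%classic : set (lebR R)).
  by apply: measurable_leb; exact: measurable_itv.
have wt0 : (0 < w t)%R by case: wP => /(_ _ Dt).
apply: (@lt_le_trans _ _ (\int[leb R]_(s in `]0%R, t]) (w t)%:E)).
  rewrite integral_cst// leb_lebesgue lebesgue_measure_itv/= lte_fin t0.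
  by rewrite oppr0 adde0 mule_gt0// lte_fin.
apply: (@le_trans _ _ (\int[leb R]_(s in `]0%R, t]) (w s)%:E)).
  apply: ge0_le_integral.
  - exact: mt.
  - by move=> s _; rewrite lee_fin ltW.
  - exact: measurable_cst.
  - by apply: measurable_weight; [exact: interval_is_interval|move=> s /sub[]].
  - move=> s /[dup] /sub [Ds _]; rewrite /= in_itv/= lee_fin => /andP[_ st].
    exact: (weight_nonincr wP).
apply: ge0_subset_integral => //.
- exact: measurable_below.
- by apply: measurable_weight => [|s []//]; exact: is_interval_below.
- by move=> s [Ds _]; exact: (weight_ge0 wP).
Qed.

Lemma weight_mass_infty : gamma = +oo -> weight_mass +oo = +oo.
Proof.
move=> goo; case: wP => _ _ _ /(_ goo) woo; rewrite -[RHS]woo /weight_mass.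
congr (\int[leb R]_(t in _) _); apply/seteqP; split => t.
  by move=> [/intvl0P[t0 _] _]; rewrite /= in_itv/= t0.
rewrite /= in_itv/= andbT => t0; split; last exact: ltry.
by apply/intvl0P; split => //; rewrite goo ltry.
Qed.

(** Dominated convergence for the restrictions of [w] to [(0, n.+1%:R^-1)]. *)
Lemma weight_mass_small (e del : R) : (0 < e)%R -> (0 < del)%R ->
  exists m r : R,
    [/\ (0 < m <= del)%R, weight_mass m%:E = r%:E & (0 < r <= e)%R].
Proof.
move=> e0 del0.
have [t0 [t00 t0g]] : exists t, (0 < t)%R /\ t%:E < gamma.
  move: gamma0; case: gamma => [r||] //.
    by rewrite lte_fin => r0; exists (r / 2)%R;
      rewrite divr_gt0// lte_fin ltr_pdivrMr// ltr_pMr// ltr1n.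
  by move=> _; exists 1%R; rewrite ltry.
have Dt0 : D t0 by apply/intvl0P.
pose J : set (lebR R) := `]0%R, t0]%classic.
have JD : J `<=` D.
  move=> s; rewrite /J /= in_itv/= => /andP[s0 st].
  by apply/intvl0P; split => //; apply: le_lt_trans t0g; rewrite lee_fin.
have mJ : measurable J by apply: measurable_leb; exact: measurable_itv.
have mw : measurable_fun J (fun t => (w t)%:E).
  by apply: measurable_weight => //; exact: interval_is_interval.
have iw : (leb R).-integrable J (fun t => (w t)%:E).
  apply/integrableP; split => //.
  under eq_integral => t /set_mem/JD Dt do rewrite gee0_abs ?(weight_ge0 wP)//.
  by case: wP => _ _ /(_ t0 (Dt0.1)).
pose f n := (fun t => (w t)%:E) \_ [set t : lebR R | (t < n.+1%:R^-1)%R].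
have mS n : measurable ([set t : lebR R | (t < n.+1%:R^-1)%R]).
  apply: measurable_leb; rewrite (_ : mkset _ = `]-oo, (n.+1%:R^-1)%R[%classic).
    exact: measurable_itv.
  by apply/seteqP; split => t /=; rewrite in_itv.
have [] := @dominated_convergence _ _ _ (leb R) J mJ f (cst 0) (fun t =>
  (w t)%:E).
- move=> n; apply/measurable_restrict => //.
  by apply: measurable_funS mw => // t [].
- exact: measurable_cst.
- apply: filterE => t; rewrite /J /= in_itv/= => /andP[t0' _].
  apply: cvg_near_cst; near=> n; rewrite /f /patch ifF//.
  apply/negbTE; rewrite notin_setE /=; apply/negP; rewrite -leNgt ltW//.
  near: n; exact: near_infty_natSinv_lt (PosNum t0').
- exact: iw.
- apply: filterE => t n /JD Dt; rewrite /f /patch; case: ifP => _.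
    by rewrite gee0_abs// (weight_ge0 wP).
  by rewrite abse0 (weight_ge0 wP).
move=> _ _; rewrite integral0 => /fine_cvgP[ffin /cvgrPdist_lt /(_ _ e0) flt].
near \oo => n.
have n1 : (n.+1%:R^-1 < Order.min del t0 :> R)%R.
  near: n; apply: (near_infty_natSinv_lt (PosNum _)).
  by rewrite lt_min del0.
have [ndel nt0] : (n.+1%:R^-1 < del :> R)%R /\ (n.+1%:R^-1 < t0 :> R)%R.
  by move: n1; rewrite lt_min => /andP.
have fE : weight_mass (n.+1%:R^-1)%R%:E = \int[leb R]_(x in J) f n x.
  rewrite /f -integral_mkcondr; congr (\int[leb R]_(t in _) _).
  apply/seteqP; split => t.
    move=> [/intvl0P[tp _] /=]; rewrite lte_fin => tn; split => //.
    by rewrite /J /= in_itv/= tp ltW// (lt_trans tn).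
  by move=> [/JD Dt tn]; split => //=; rewrite lte_fin.
have fin : weight_mass (n.+1%:R^-1)%R%:E \is a fin_num.
  by rewrite fE; near: n.
exists n.+1%:R^-1%R, (fine (weight_mass (n.+1%:R^-1)%R%:E)); split.
- by rewrite invr_gt0 ltr0n ltW.
- by rewrite fineK.
apply/andP; split.
  by rewrite -lte_fin fineK// weight_mass_gt0// lte_fin invr_gt0 ltr0n.
rewrite ltW// fE (le_lt_trans (ler_norm _))//.
have : (`|0 - fine (\int[leb R]_(x in J) f n x)| < e)%R by near: n.
by rewrite sub0r normrN.
Unshelve. all: by end_near. Qed.

End WeightMass.

(** * The modular of a function *)

Section Distribution.
Context {R : realType} {gamma : \bar R}.
Local Notation L := (L0 gamma).
Local Notation I := (intvl gamma : set (lebR R)).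
Implicit Types (f g h : L) (l : R).

Definition superlevel f l : set (lebR R) := I `&` [set t | (l < `|f t|)%R].

Lemma measurable_superlevel f l : measurable (superlevel f l).
Proof.
apply: measurableI; first exact: measurable_intvl.
rewrite -[X in measurable X]setTI.
have -> : [set t : lebR R | (l < `|f t|)%R] = f @^-1` (`]l, +oo[ `|` `]-oo, -
  l[)%classic.
  apply/seteqP; split=> t /=; rewrite !in_itv /= andbT.
    by rewrite lter_normr => /orP[|]; [left|right; rewrite ltrNr].
  by rewrite lter_normr => -[->//|]; rewrite ltrNr => ->; rewrite orbT.
by apply: measurable_L0 => //; apply: measurableU; exact: measurable_itv.
Qed.

Local Open Scope ereal_scope.

Lemma distribution_funE f l : distribution_fun f l = leb R (superlevel f l).
Proof. by []. Qed.

Lemma distribution_ge0 f l : 0 <= distribution_fun f l.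
Proof. exact: measure_ge0. Qed.

Lemma le_measure_ae (A B : set (lebR R)) : measurable A -> measurable B ->
  A `<=` I -> (\forall t \ae lebI gamma, A t -> B t) -> leb R A <= leb R B.
Proof.
move=> mA mB AI /aeI_P[N [mN N0] AB].
apply: (@le_trans _ _ (leb R (B `|` N))).
  apply: le_measure; rewrite ?inE; [exact: mA|exact: measurableU|].
  move=> t At; have [Nt|Nt] := pselect (N t); first by right.
  by left; apply: AB => //; exact: AI.
apply: le_trans (measureU2 _ mB mN) _.
by rewrite [X in _ + X <= _](_ : _ = 0)// adde0.
Qed.

Lemma le_distribution f g l l' :
  (\forall t \ae lebI gamma, (l < `|f t|)%R -> (l' < `|g t|)%R) ->
  distribution_fun f l <= distribution_fun g l'.
Proof.
move=> fg; apply: le_measure_ae;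
  [exact: measurable_superlevel|exact: measurable_superlevel|by move=> t []|].
by apply: filterS fg => t fg [It]; split=> //; exact: fg.
Qed.

Lemma distribution_nonincr f l l' : (l <= l')%R ->
  distribution_fun f l' <= distribution_fun f l.
Proof.
by move=> ll'; apply: le_distribution; apply: filterE => t; exact: le_lt_trans.
Qed.

(** Where [l < `|f + g|], the larger of [`|2 *: f|] and [`|2 *: g|] exceeds
    [l]. *)
Lemma distribution_add f g l :
  distribution_fun (f + g)%R l <=
  distribution_fun (2%R *: f) l + distribution_fun (2%R *: g) l.
Proof.
rewrite !distribution_funE.
apply: (@le_trans _ _ (leb R (superlevel (2%R *: f) l `|` superlevel (2%R *: g)
  l))).
  apply: le_measure_ae; [exact: measurable_superlevel| |by move=> t []|].
    by apply: measurableU; exact: measurable_superlevel.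
  apply: filterS3 (L0_addE_ae f g) (L0_scaleE_ae 2 f) (L0_scaleE_ae 2 g) => t.
  rewrite /superlevel /= => -> Ef Eg [It lt].
  have : (l < `|f t| + `|g t|)%R by apply: lt_le_trans lt _; exact: ler_normD.
  rewrite Ef Eg !normrM (@ger0_norm _ 2)// => {}lt.
  have [fg|/ltW gf] := leP `|f t|%R `|g t|%R; [right|left]; split => //=; lra.
by apply: measureU2; exact: measurable_superlevel.
Qed.

Lemma ae_scale_le k f g : (\forall t \ae lebI gamma, (`|f t| <= `|g t|)%R) ->
  \forall t \ae lebI gamma, (`|(k *: f : L) t| <= `|(k *: g : L) t|)%R.
Proof.
apply: filterS3 (L0_scaleE_ae k f) (L0_scaleE_ae k g) => t -> -> fg.
by rewrite !normrM ler_wpM2l.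
Qed.

Variables (w phi : R -> R).
Hypothesis gamma0 : 0 < gamma.
Hypothesis wP : weight_function gamma w.
Hypothesis phiO : orlicz_function phi.
Local Notation rho := (modular phi w).
Local Notation N := (luxemburg_norm phi w).

Lemma modular_ge0 f : 0 <= rho f.
Proof. exact: dmod_ge0. Qed.

Lemma le_modular f g : (\forall t \ae lebI gamma, (`|f t| <= `|g t|)%R) ->
  rho f <= rho g.
Proof.
move=> fg; rewrite !modularE; apply: le_dmod => // l _; apply: le_distribution.
by apply: filterS fg => t fg lt; exact: lt_le_trans fg.
Qed.

Lemma le_luxemburg_norm f g : (\forall t \ae lebI gamma, (`|f t| <= `|g t|)%R)
  ->
  N f <= N g.
Proof.
move=> fg; apply: le_ereal_inf_tmp => _ [e [e0 ge] <-].
apply: ereal_inf_lbound; exists e; last by [].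
split; first exact: e0.
by apply: le_trans ge; apply: le_modular; exact: ae_scale_le.
Qed.

Lemma luxemburg_norm_ge0 f : 0 <= N f.
Proof. by apply: le_ereal_inf_tmp => _ [e [e0 _] <-]; rewrite lee_fin ltW. Qed.

Lemma dmod0 : dmod (gamma := gamma) w phi (cst 0) = 0.
Proof.
apply/eqP; rewrite eq_le dmod_ge0// andbT.
apply: le_trans (dmod_block_upper wP phiO (u := 1%R) (m := 0) _ _) _ => //.
  by move=> l _; case: ifP.
rewrite /weight_mass (_ : below 0 = set0) ?integral_set0 ?mule0//.
by apply/seteqP; split => // t [/intvl0P[t0 _] /=]; rewrite lte_fin ltNge ltW.
Qed.

(** A substitute for the triangle inequality: it makes the spaces linear
    without comparing norms. *)
Lemma modular_add_lty f g : rho (2%R *: f) < +oo -> rho (2%R *: g) < +oo ->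
  rho (f + g)%R < +oo.
Proof.
move=> foo goo.
pose d_ (i : nat) : R -> \bar R := match i with
  | 0%N => distribution_fun (2%R *: f) | 1%N => distribution_fun (2%R *: g)
  | _ => cst 0 end.
apply: (@le_lt_trans _ _ (\sum_(i <oo) (2 ^ i.+1)%:R%:E * dmod (gamma :=
  gamma) w phi (d_ i))).
  rewrite modularE; apply: dmod_nneseries => //.
  - by move=> [|[|i]] l //=; exact: distribution_ge0.
  - by move=> [|[|i]] l l' //=; exact: distribution_nonincr.
  - move=> l l0; apply: le_trans (distribution_add f g l) _.
    apply: le_trans (nneseries_lim_ge 2 _); last first.
      by move=> [|[|i]] //= _ _; exact: distribution_ge0.
    by rewrite !big_nat_recr//= big_geq// add0e.
rewrite (nneseries_split 0 2); last first.
  by move=> i _; rewrite mule_ge0// dmod_ge0.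
rewrite eseries0 ?adde0; last by move=> [|[|i]] //= _ _; rewrite dmod0 mule0.
have sum2 (u : nat -> \bar R) : \sum_(0 <= k < 0 + 2) u k = u 0%N + u 1%N.
  by rewrite add0n !big_nat_recr//= big_geq// add0e.
rewrite sum2 {sum2}; apply: lte_add_pinfty; apply: lte_mul_pinfty.
- by rewrite lee_fin.
- by [].
- exact: foo.
- by rewrite lee_fin.
- by [].
- exact: goo.
Qed.

(** The point is the case of an infinite interval: a superlevel set of
    infinite measure would contribute [phi l] times the total mass of the
    weight, which is infinite. *)
Lemma distribution_lty f l : (0 < l)%R -> rho f < +oo ->
  distribution_fun f l < +oo.
Proof.
move=> l0 foo; rewrite ltey; apply/eqP => doo.
have [goo|gfin] := eqVneq gamma +oo; last first.
  move: doo; apply/eqP; rewrite -ltey.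
  have gE : gamma = (fine gamma)%:E by move: gamma0 gfin; case: gamma.
  apply: (@le_lt_trans _ _ (leb R `[0%R, fine gamma]%classic)).
    apply: le_measure; rewrite ?inE.
    - exact: measurable_superlevel.
    - by apply: measurable_leb; exact: measurable_itv.
    - move=> t [[t0 tg] _]; rewrite /= in_itv/= t0.
      by move: tg; rewrite {1}gE lte_fin => /ltW.
  by rewrite leb_lebesgue lebesgue_measure_itv/=; case: ifP; rewrite ltry.
have := @dmod_lower _ _ w phi wP phiO (distribution_fun f) l +oo (ltW l0) _.
rewrite (weight_mass_infty wP goo) gt0_muley ?lte_fin ?orlicz_gt0// => h.
move: foo; rewrite modularE ltNge h// => l' /andP[_ /ltW l'l].
by rewrite -doo; exact: distribution_nonincr.
Qed.

End Distribution.

(** * Order continuity and convergence in the Luxemburg norm *)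

Section Convergence.
Context {R : realType} {gamma : \bar R}.
Local Notation L := (L0 gamma).
Local Notation I := (intvl gamma : set (lebR R)).
Implicit Types (f g h : L) (l : R).
Local Open Scope ereal_scope.

Lemma cvge0_le (x : nat -> \bar R) : (forall n, 0 <= x n) ->
  (forall e : R, (0 < e)%R -> \forall n \near \oo, x n <= e%:E) ->
  x n @[n --> \oo] --> 0.
Proof.
move=> x0 xe; apply/fine_cvgP; split.
  by apply: filterS (xe 1%R ltr01) => n xn;
    rewrite ge0_fin_numE// (le_lt_trans xn) ?ltry.
apply/cvgrPdist_le => e e0; apply: filterS (xe e e0) => n xn /=.
rewrite sub0r normrN ger0_norm ?fine_ge0// -lee_fin fineK//.
by rewrite ge0_fin_numE// (le_lt_trans xn) ?ltry.
Qed.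

Lemma cvge0P (x : nat -> \bar R) (e : R) : (0 < e)%R ->
  x n @[n --> \oo] --> 0 -> \forall n \near \oo, x n <= e%:E.
Proof.
move=> e0 /fine_cvgP[xfin /cvgrPdist_le/(_ _ e0) xe].
apply: filterS2 xfin xe => n xn /=; rewrite sub0r normrN => xe.
by rewrite -(fineK xn) lee_fin; apply: le_trans xe; exact: ler_norm.
Qed.

(** On a set of finite measure, almost everywhere convergence implies
    convergence in measure; here the finite measure is that of a superlevel
    set of the dominating function. *)
Lemma distribution_cvg0 f (h : nat -> L) l : (0 < l)%R ->
  distribution_fun f l < +oo ->
  (forall n, \forall t \ae lebI gamma, (`|h n t| <= `|f t|)%R) ->
  (\forall t \ae lebI gamma, h n t @[n --> \oo] --> (0 : R)%R) ->
  distribution_fun (h n) l @[n --> \oo] --> 0.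
Proof.
move=> l0 foo /ae_foralln hf h0.
pose E n := superlevel (h n) l.
have mE n : measurable (E n) by exact: measurable_superlevel.
have mU n : measurable (\bigcup_(k >= n) E k) by exact: bigcup_measurable.
have Uoo : leb R (\bigcup_(k >= 0) E k) < +oo.
  apply: le_lt_trans foo; rewrite distribution_funE;
    apply: (le_measure_ae (gamma := gamma)).
  - exact: mU.
  - exact: measurable_superlevel.
  - by move=> t [k _ []].
  - apply: filterS hf => t hf [k _ [It lt]]; split => //.
    exact: lt_le_trans lt (hf k).
have S0 : leb R (lim_sup_set E) = 0.
  apply/eqP; rewrite eq_le measure_ge0 andbT -(measure0 (leb R)).
  apply: (le_measure_ae (gamma := gamma)).
  - by apply: bigcap_measurable => // k _; exact: mU.
  - exact: measurable0.
  - by move=> t /(_ 0%N Logic.I)[k _ []].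
  - apply: filterS h0 => t /cvgrPdist_lt/(_ _ l0)[n _ nh] /(_ n Logic.I)[k nk
    [_ /=]].
    by have := nh k nk; rewrite sub0r normrN => /ltW; rewrite leNgt => /negP.
have Ucvg := lim_sup_set_cvg (leb R) E mE Uoo; rewrite S0 in Ucvg.
apply: cvge0_le => [n|e e0]; first exact: distribution_ge0.
apply: filterS (cvge0P e0 Ucvg) => n; apply: le_trans.
by apply: le_measure; rewrite ?inE; [exact: mE|exact: mU|move=> t Et;
  exists n => /=].
Qed.

Variables (w phi : R -> R).
Hypothesis gamma0 : 0 < gamma.
Hypothesis wP : weight_function gamma w.
Hypothesis phiO : orlicz_function phi.
Local Notation rho := (modular phi w).
Local Notation N := (luxemburg_norm phi w).

(** The rearrangements of the [h n] tend to 0 pointwise, by convergence in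
    measure, and the integrand of [f] dominates theirs. *)
Lemma modular_cvg0 f (h : nat -> L) : rho f < +oo ->
  (forall n, \forall t \ae lebI gamma, (`|h n t| <= `|f t|)%R) ->
  (\forall t \ae lebI gamma, h n t @[n --> \oo] --> (0 : R)%R) ->
  rho (h n) @[n --> \oo] --> 0.
Proof.
move=> foo hf h0.
pose F n : R -> \bar R := integrand w phi (distribution_fun (h n)).
pose G : R -> \bar R := integrand w phi (distribution_fun f).
have FG n t : intvl0 gamma t -> F n t <= G t.
  move=> Dt; apply: (le_integrand wP phiO Dt Dt (lexx t)) => l _.
  by apply: le_distribution; apply: filterS (hf n) => s fg lt;
    exact: lt_le_trans fg.
have F0 n t : intvl0 gamma t -> 0 <= F n t by move=> Dt;
  exact: (integrand_ge0 wP phiO).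
have [] := @dominated_convergence _ _ _ (leb R) (intvl0 gamma)
    (@measurable_intvl0_leb _ _) F (cst 0) G.
- by move=> n; exact: (measurable_integrand_leb wP phiO).
- exact: measurable_cst.
- apply: filterE => t Dt; have [t0 _] := (intvl0P t).1 Dt.
  have wt0 : (0 < w t)%R by case: wP => /(_ _ Dt).
  have p1 : (0 < phi 1)%R by exact: (orlicz_gt0 phiO).
  have wge : 0 <= (w t)%:E by rewrite lee_fin ltW.
  apply: cvge0_le => [n|e e0]; first exact: F0.
  pose s : R := Order.min 1%R (e / (phi 1 * w t))%R.
  have s0 : (0 < s)%R by rewrite lt_min ltr01 divr_gt0// mulr_gt0.
  have s1 : (s <= 1)%R by rewrite ge_min lexx.
  have se : (s * phi 1 * w t <= e)%R.
    rewrite -mulrA -ler_pdivlMr ?mulr_gt0//; by rewrite /s ge_min lexx orbT.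
  have dcvg := distribution_cvg0 s0 (distribution_lty gamma0 wP phiO s0 foo) hf
    h0.
  apply: filterS (cvge0P t0 dcvg) => n dn.
  rewrite /F /integrand; apply: (@le_trans _ _ ((phi s)%:E * (w t)%:E)).
    apply: lee_wpmul2r; first exact: wge.
    by apply: (@er_map_le _ _ phiO _ s%:E); [exact: rearr_ge0|exact: rearr_le].
  rewrite -EFinM lee_fin; apply: le_trans se; rewrite ler_pM2r//.
  by have := orlicz_shrink phiO (ltW s0) s1 ler01; rewrite mulr1.
- apply/integrableP; split; first exact: (measurable_integrand_leb wP phiO).
  suff -> : \int[leb R]_(t in intvl0 gamma) `|G t| = rho f by exact: foo.
  apply: eq_integral.
  by move=> t /set_mem Dt; rewrite gee0_abs//; exact: (integrand_ge0 wP phiO).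
- apply: filterE => t n Dt; rewrite gee0_abs; [exact: FG|exact: F0].
by move=> _ _; rewrite integral0.
Qed.

Lemma order_continuous_of_modular f : (forall k : R, (0 < k)%R ->
  rho (k *: f) < +oo) ->
  order_continuous phi w f.
Proof.
move=> fP; split; first by exists 1%R; [exact: ltr01|exact: (fP _ ltr01)].
move=> g gf gP; split.
  move=> m n mn; apply: le_luxemburg_norm => //.
  by apply: filterS gP => t [+ _]; apply.
apply: cvge0_le => [n|e e0]; first exact: luxemburg_norm_ge0.
have e0' : (0 < e^-1)%R by rewrite invr_gt0.
have : rho (e^-1 *: g n)%R @[n --> \oo] --> 0.
  apply: modular_cvg0 (fP _ e0') _ _ => [n|]; first exact: ae_scale_le.
  have : \forall t \ae lebI gamma, forall n, (e^-1 *: g n : L)%R t = (e^-1 * g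
    n t)%R.
    by apply: ae_foralln => n; exact: L0_scaleE_ae.
  apply: filterS2 gP => t [_ gt0] gE.
  rewrite (_ : (fun n => _) = (fun n => e^-1 * g n t)%R); last by apply/funext.
  have /norm_cvg0 g0 : `|g n t|%R @[n --> \oo] --> (0 : R)%R by exact: gt0.
  have := @cvgMl_tmp R _ _ _ _ (e^-1)%R _ g0; rewrite mulr0; apply.
move=> /(cvge0P ltr01); apply: filterS => n ge.
by apply: ereal_inf_lbound; exists e; [split|].
Qed.

(** Luxemburg convergence implies convergence in measure: by convexity [phi
    (eps / e) >= phi eps / e] for [e <= 1], so that the modular of [h / e]
    exceeds 1 for small [e] as soon as [h] exceeds [eps] on a set of measure
    greater than [eta]. *)
Lemma distribution_small (eps eta : R) : (0 < eps)%R -> (0 < eta)%R ->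
  exists2 del : R, (0 < del)%R &
    forall h, N h < del%:E -> distribution_fun h eps <= eta%:E.
Proof.
move=> eps0 eta0.
have p0 : (0 < phi eps)%R by exact: (orlicz_gt0 phiO).
have W0 : 0 < (phi eps)%:E * weight_mass (gamma := gamma) w eta%:E.
  by rewrite mule_gt0// ?lte_fin// weight_mass_gt0// lte_fin.
have [del [del0 del1 delW]] : exists del : R, [/\ (0 < del)%R, (del <= 1)%R &
    del%:E <= (phi eps)%:E * weight_mass (gamma := gamma) w eta%:E].
  move: W0; case: (_ * _) => [r||] //.
    rewrite lte_fin => r0; exists (Order.min 1%R r).
    by rewrite lt_min ltr01 r0 ge_min lexx lee_fin ge_min lexx orbT.
  by move=> _; exists 1%R; rewrite ltr01 lexx leey.
exists del => // h /ereal_inf_lt[_ [e [e0 he] <-]]; rewrite lte_fin => edel.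
rewrite leNgt; apply/negP => heta; move: he; apply/negP; rewrite -ltNge.
have e1 : (1 <= e^-1)%R by rewrite invf_ge1// (le_trans (ltW edel)).
have e0' : (0 < e^-1)%R by rewrite invr_gt0.
apply: (@lt_le_trans _ _ ((phi (e^-1 * eps))%:E * weight_mass (gamma :=
  gamma) w eta%:E)).
  apply: (@lt_le_trans _ _ (e^-1%:E * del%:E)).
    by rewrite -EFinM lte_fin ltr_pdivlMl// mulr1.
  apply: (@le_trans _ _ (e^-1%:E * ((phi eps)%:E * weight_mass (gamma :=
    gamma) w eta%:E))).
    by rewrite lee_pmul2l// lte_fin.
  rewrite muleA -EFinM; apply: lee_wpmul2r.
    by apply/ltW/weight_mass_gt0 => //; rewrite lte_fin.
  by rewrite lee_fin; apply: (orlicz_expand phiO) => //; exact: ltW.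
rewrite modularE; apply: (dmod_lower wP phiO).
  by rewrite mulr_ge0// ltW.
move=> l /andP[_ lt]; apply/ltW; apply: lt_le_trans heta _.
apply: le_distribution; apply: filterS (L0_scaleE_ae e^-1%R h) => t -> hlt.
rewrite normrM gtr0_norm//; apply: lt_trans lt _.
by rewrite ltr_pM2l.
Qed.

(** Borel-Cantelli: the [n]-th approximant is chosen within [2 ^- n.+1] of
    [f] outside a set of measure [2 ^- n.+1]. *)
Lemma norm_closure_ae (X M : set L) f : norm_closure X N M f ->
  exists2 y : nat -> L, (forall n, M (y n)) &
    \forall t \ae lebI gamma, y n t @[n --> \oo] --> f t.
Proof.
move=> [_ fM].
pose a n : R := (1 / (2 ^ n.+1)%:R)%R.
have a0 n : (0 < a n)%R by rewrite divr_gt0// ltr0n expn_gt0.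
have /choice[y yP] n : exists y, M y /\ distribution_fun (y - f)%R (a n) <= (a
  n)%:E.
  have [del del0 delP] := distribution_small (a0 n) (a0 n).
  by have [y My Ny] := fM _ del0; exists y; split => //; exact: delP.
exists y; first by move=> n; have [] := yP n.
pose E n := superlevel (y n - f)%R (a n).
have mE n : measurable (E n) by exact: measurable_superlevel.
have S0 : leb R (lim_sup_set E) = 0.
  apply: lim_sup_set_cvg0; first exact: mE.
  apply: (@le_lt_trans _ _ 1%:E); last exact: ltry.
  apply: le_trans (epsilon_trick0 xpredT ler01);
    apply: lee_nneseries => [n _ _|n _].
    exact: measure_ge0.
  by have [] := yP n.
have aS : \forall t \ae lebI gamma, ~ lim_sup_set E t.
  apply/aeI_P; exists (lim_sup_set E); last by [].
  split => //; apply: bigcap_measurable => // k _; exact: bigcup_measurable.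
have ayf : \forall t \ae lebI gamma, forall n, (y n - f : L)%R t = (y n t - f
  t)%R.
  apply: ae_foralln => n.
  by apply: filterS2 (L0_addE_ae (y n) (- f)%R) (L0_oppE_ae f) => t -> ->.
have aI : \forall t \ae lebI gamma, intvl gamma t.
  by apply/aeI_P; exists set0; rewrite ?measure0.
apply: filterS3 aS ayf aI => t St yf It.
have [n yn] : exists n, forall k, (n <= k)%N -> (`|y k t - f t| <= a k)%R.
  apply: contrapT => /forallNP h; apply: St => n _; apply: contrapT => hn.
  apply: (h n) => k nk; rewrite leNgt; apply/negP => lt; apply: hn.
  by exists k => //; split => //=; rewrite yf.
apply/cvgrPdist_le => e e0; near=> k.
rewrite distrC (le_trans (yn k _))//; first by near: k; exact: nbhs_infty_ge.
rewrite /a div1r; apply: (@le_trans _ _ (k.+1%:R^-1)%R).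
  rewrite lef_pV2 ?posrE ?ltr0n ?expn_gt0// ler_nat.
  by apply: leq_trans (ltnW (ltn_expl k.+1 (isT : 1 < 2)%N)) _.
by apply/ltW; near: k; exact: (near_infty_natSinv_lt (PosNum e0)).
Unshelve. all: by end_near. Qed.

End Convergence.

(** * The choice of the peaks *)

Section Bump.
Context {R : realType} {gamma : \bar R}.
Variables (w phi : R -> R) (psi : nat -> R -> R).
Hypothesis gamma0 : (0 < gamma)%E.
Hypothesis wP : weight_function gamma w.
Hypothesis phiO : orlicz_function phi.
Hypothesis psiD : forall n, Delta_infty phi (psi n).
Local Notation W := (weight_mass (gamma := gamma) w).

(** The width [m] is chosen first, so small that the largest integer height
    [u] with [4 ^+ j * phi (j * u) * W m <= 1] exceeds all thresholds; by
    maximality [4 ^+ j * phi (2 * j * u) * W m > 1], and [psi n] beats any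
    dilation of [phi] beyond the thresholds. *)
Lemma bump_exists (j : nat) (del : R) : (0 < j)%N -> 0 < del ->
  exists m u W0 : R, [/\ 0 < m <= del, 0 < u, W m%:E = W0%:E,
    4 ^+ j * phi (j%:R * u) * W0 <= 1 &
    forall n, (n < j)%N -> j%:R <= psi n (j%:R^-1 * u) * W0].
Proof.
move=> j0 del0; have jR0 : 0 < j%:R :> R by rewrite ltr0n.
have j1 : 1 <= j%:R :> R by rewrite ler1n.
have q1 : 1 <= 4 ^+ j :> R by rewrite exprn_ege1// ler1n.
have q0 : 0 < 4 ^+ j :> R by rewrite exprn_gt0.
(* With [phi (C * u) <= psi n (u / j)], the factor [j * 4 ^+ j] comes out of
   [phi] by convexity and turns [4 ^+ j * phi (2 * j * u) * W0 > 1] into the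
   lower bound [j]. *)
pose C : R := (j%:R * 4 ^+ j) * (2 * j%:R).
have jq1 : 1 <= j%:R * 4 ^+ j :> R by rewrite mulr_ege1.
have C1 : 1 <= C by rewrite /C mulr_ege1// mulr_ege1// ler1n.
have C0 : 0 < C by apply: lt_le_trans C1.
have b0 : 0 < (j%:R * C)^-1 by rewrite invr_gt0 mulr_gt0.
have /choice[u0 u0P] : forall n, exists u0, forall u, 0 <= u -> u0 <= u ->
    phi u <= psi n ((j%:R * C)^-1 * u) by move=> n; exact: psiD.
pose N0 := (\sum_(n < j) (Num.truncn `|u0 n|).+1).+1%N.
have N0P n : (n < j)%N -> u0 n <= N0%:R.
  move=> nj; apply: le_trans (ler_norm _) _; apply/ltW.
  apply: lt_le_trans (truncnS_gt _) _; rewrite ler_nat.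
  by apply: leq_trans (leqnSn _); rewrite (bigD1 (Ordinal nj))//= leq_addr.
have phiN n : (0 < n)%N -> 0 < phi (j%:R * n%:R).
  by move=> n0; apply: (orlicz_gt0 phiO); rewrite mulr_gt0// ltr0n.
have e0 : 0 < (4 ^+ j * phi (j%:R * N0%:R))^-1.
  by rewrite invr_gt0 mulr_gt0// phiN.
have [m [W0 [mdel WE /andP[W00 We]]]] := weight_mass_small gamma0 wP e0 del0.
pose Q N := 1 < 4 ^+ j * phi (j%:R * N%:R) * W0.
have exQ : exists N, Q N.
  (* [phi] grows at least linearly, which gives an explicit [N]. *)
  pose x := (4 ^+ j * phi j%:R * W0)^-1.
  have p0 : 0 < phi j%:R by exact: (orlicz_gt0 phiO).
  have x0 : 0 < 4 ^+ j * phi j%:R * W0 by rewrite !mulr_gt0.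
  exists (Num.truncn x).+1; rewrite /Q.
  have N1 : 1 <= (Num.truncn x).+1%:R :> R by rewrite ler1n.
  apply: (@lt_le_trans _ _ ((Num.truncn x).+1%:R * (4 ^+ j * phi j%:R * W0))).
    by rewrite -ltr_pdivrMr// div1r truncnS_gt.
  have := orlicz_expand phiO N1 (ltW jR0).
  rewrite [_ * j%:R]mulrC => h.
  rewrite [leLHS](_ : _ = 4 ^+ j * ((Num.truncn x).+1%:R * phi j%:R) * W0);
    last by ring.
  by rewrite ler_pM2r// ler_pM2l.
(* The height [u] is the predecessor of [N], and [N <= 2 * u]. *)
have [N QN minN] := ex_minnP exQ.
have N0N : (N0 < N)%N.
  rewrite ltnNge; apply/negP => NN0; move: QN; rewrite /Q; apply/negP;
    rewrite -leNgt.
  apply: (@le_trans _ _ (4 ^+ j * phi (j%:R * N0%:R) * W0)).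
    rewrite ler_pM2r// ler_pM2l//; apply: (orlicz_le phiO).
      by rewrite mulr_ge0// ltW.
    by rewrite ler_pM2l// ler_nat.
  by rewrite -ler_pdivlMl ?mulr1// mulr_gt0// phiN.
case: N N0N QN minN => // u; rewrite ltnS => N0u QN minN.
have u1 : (0 < u)%N by apply: leq_trans N0u.
have uR0 : 0 < u%:R :> R by rewrite ltr0n.
exists m, u%:R, W0; split => //.
  by rewrite leNgt; apply/negP => /minN; rewrite ltnn.
move=> n nj.
have h1 : phi (C * u%:R) <= psi n (j%:R^-1 * u%:R).
  have -> : j%:R^-1 * u%:R = (j%:R * C)^-1 * (C * u%:R).
    by rewrite invfM -[RHS]mulrA mulKf ?gt_eqF.
  apply: u0P; first by rewrite mulr_ge0// ltW.
  apply: le_trans (N0P n nj) _; apply: (@le_trans _ _ u%:R);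
    first by rewrite ler_nat.
  by rewrite ler_peMl// ltW.
have h2 : j%:R * 4 ^+ j * phi (2 * j%:R * u%:R) <= phi (C * u%:R).
  rewrite /C -[in leRHS]mulrA; exact: (orlicz_expand phiO).
have h3 : 1 <= 4 ^+ j * phi (2 * j%:R * u%:R) * W0.
  apply: le_trans (ltW QN) _; rewrite ler_pM2r// ler_pM2l//.
  apply: (orlicz_le phiO); first by rewrite mulr_ge0// ltW.
  rewrite mulrAC mulrC ler_pM2r// -natrM ler_nat.
  by rewrite mul2n -addnn -addn1 leq_add2l.
apply: (@le_trans _ _ (phi (C * u%:R) * W0)); last by rewrite ler_pM2r.
apply: (@le_trans _ _ (j%:R * 4 ^+ j * phi (2 * j%:R * u%:R) * W0));
  last by rewrite ler_pM2r.
rewrite [leRHS](_ : _ = j%:R * (4 ^+ j * phi (2 * j%:R * u%:R) * W0));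
  last by ring.
by rewrite ler_peMr// ltW.
Qed.

End Bump.

(** * Step functions on disjoint blocks *)

Section Steps.
Context {R : realType} {gamma : \bar R}.
Local Notation L := (L0 gamma).
Variable A : nat -> set (lebR R).
Hypothesis mA : forall i, measurable (A i).
Hypothesis AI : forall i, A i `<=` intvl gamma.
Hypothesis tA : forall i j t, A i t -> A j t -> i = j.
Implicit Types (f g : L) (a b : nat -> R).

Definition steps a f : Prop := \forall t \ae lebI gamma,
  (forall i, A i t -> f t = a i) /\ ((forall i, ~ A i t) -> f t = 0).

Lemma steps_exist a : exists f, steps a f.
Proof.
pose u (t : lebR R) : R :=
  if pselect (exists i, A i t) is left e then a (projT1 (cid e)) else 0.
have uA i t : A i t -> u t = a i.
  move=> At; rewrite /u; case: pselect => [e|[]]; last by exists i.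
  by case: cid => j /= Aj; rewrite (tA Aj At).
have uN t : (forall i, ~ A i t) -> u t = 0.
  by move=> Nt; rewrite /u; case: pselect => // -[i At]; case: (Nt i At).
have mu : measurable_fun setT u.
  move=> _ Y mY; rewrite setTI.
  have -> : u @^-1` Y = (\bigcup_(i in [set i | Y (a i)]) A i) `|`
      ([set t | Y 0] `\` \bigcup_i A i).
    apply/seteqP; split => t /=.
      move=> Yt; have [[i At]|Nt] := pselect (exists i, A i t).
        by left; exists i => //=; rewrite -(uA i t).
      right; rewrite -(uN t) => [|i At]; last by apply: Nt; exists i.
      by split => // -[i _ At]; apply: Nt; exists i.
    move=> [[i Yi At]|[Y0 Nt]]; first by rewrite (uA i t).
    by rewrite uN// => i At; apply: Nt; exists i.
  apply: measurableU; first exact: bigcup_measurable.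
  apply: measurableD; last exact: bigcupT_measurable.
  have [Y0|Y0] := pselect (Y 0).
    by rewrite (_ : mkset _ = setT); [exact: measurableT|apply/seteqP; split].
  by rewrite (_ : mkset _ = set0); [exact: measurable0|apply/seteqP; split].
have [f fu] := L0_of_fun (gamma := gamma) mu; exists f.
by apply: filterS fu => t ->; split; [move=> i; exact: uA|exact: uN].
Qed.

Lemma steps0 : steps (fun=> 0) (0 : L).
Proof. by apply: filterS (@L0_zeroE_ae R gamma) => t ->. Qed.

Lemma steps_lin c a b f g : steps a f -> steps b g ->
  steps (fun i => c * a i + b i) (c *: f + g).
Proof.
move=> fa gb.
have E : \forall t \ae lebI gamma, (c *: f + g : L) t = c * f t + g t.
  by apply: filterS2 (L0_addE_ae (c *: f) g) (L0_scaleE_ae c f) => t -> ->.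
apply: filterS3 E fa gb => t -> [fA f0] [gA g0]; split => [i At|Nt].
  by rewrite (fA i)// (gA i).
by rewrite f0// g0// mulr0 addr0.
Qed.

Lemma eq_steps a b f : a =1 b -> steps a f -> steps b f.
Proof. by move=> ab; have -> : b = a by apply/funext => i; rewrite ab. Qed.

Lemma steps_scale c a f : steps a f -> steps (fun i => c * a i) (c *: f).
Proof.
move=> fa; rewrite -[c *: f]addr0.
by apply: eq_steps (steps_lin c fa steps0) => i; rewrite addr0.
Qed.

Lemma steps_eq0 f : steps (fun=> 0) f -> f = 0.
Proof.
move=> f0; apply: L0_eq; apply: filterS2 f0 (@L0_zeroE_ae R gamma) =>
  t [fA fN] ->.
have [[i At]|Nt] := pselect (exists i, A i t); first by rewrite (fA i).
by apply: fN => i At; apply: Nt; exists i.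
Qed.

Hypothesis A0 : forall i, (0 < leb R (A i))%E.

(** This is how properties known almost everywhere become equalities between
    the values on the blocks. *)
Lemma ae_meet (P : lebR R -> Prop) i : (\forall t \ae lebI gamma, P t) ->
  exists2 t, A i t & P t.
Proof.
move=> /aeI_P[N [mN N0] NP]; apply: contrapT => h.
have : (leb R (A i) <= leb R N)%E.
  apply: le_measure; rewrite ?inE; [exact: mA|exact: mN|] => t At.
  by apply: contrapT => Nt; apply: h; exists t => //; apply: NP => //;
    exact: AI At.
by apply/negP; rewrite -ltNge N0.
Qed.

Lemma steps_inj a b f : steps a f -> steps b f -> a =1 b.
Proof.
move=> fa fb i; have [t At [E1 E2]] := ae_meet i (filterI fa fb).
by rewrite -(E1.1 i)// -(E2.1 i).
Qed.

(** The values on the blocks converge because each block, being of positive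
    measure, contains a point of convergence. *)
Lemma steps_limit (a : nat -> nat -> R) (y : nat -> L) f :
  (forall n, steps (a n) (y n)) ->
  (\forall t \ae lebI gamma, y n t @[n --> \oo] --> f t) ->
  exists2 b, steps b f & forall i, a n i @[n --> \oo] --> b i.
Proof.
move=> ya yf; have {}ya := ae_foralln ya.
have /choice[b bP] i : exists x : R, a n i @[n --> \oo] --> x.
  have [t At [yt ft]] := ae_meet i (filterI ya yf).
  by exists (f t); under eq_fun do rewrite -((yt _).1 i At).
exists b => //; apply: filterS2 ya yf => t yt ft; split => [i At|Nt].
  apply: norm_cvg_unique ft _.
  have -> : (fun n => y n t) = a ^~ i by apply/funext => n;
    rewrite ((yt n).1 i).
  exact: bP.
apply: norm_cvg_unique ft _.
have -> : (fun n => y n t) = cst 0 by apply/funext => n; rewrite (yt n).2.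
exact: cvg_cst.
Qed.

Variables (w phi : R -> R).
Hypothesis gamma0 : (0 < gamma)%E.
Hypothesis wP : weight_function gamma w.
Hypothesis phiO : orlicz_function phi.
Local Open Scope ereal_scope.

(** The distribution of [f] is at most the sum of those of its blocks. *)
Lemma modular_steps_le a f : steps a f ->
  (forall i, a i != 0%R) ->
  modular phi w f <= \sum_(i <oo) (2 ^ i.+1)%:R%:E *
    ((phi `|a i|%R)%:E * weight_mass (gamma := gamma) w (leb R (A i))).
Proof.
move=> fa a0.
pose d_ i l := if (l < `|a i|)%R then leb R (A i) else 0.
apply: (@le_trans _ _ (\sum_(i <oo) (2 ^ i.+1)%:R%:E * dmod (gamma :=
  gamma) w phi (d_ i))).
  rewrite modularE; apply: dmod_nneseries; [exact: wP|exact: phiO| | |].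
  - by move=> i l; rewrite /d_; case: ifP => // _; exact: measure_ge0.
  - move=> i l l' ll'; rewrite /d_; case: ifP => [h|_].
      by rewrite (le_lt_trans ll' h).
    by case: ifP => // _; exact: measure_ge0.
  - move=> l l0; pose B i := if (l < `|a i|)%R then A i else set0.
    have mB i : measurable (B i) by rewrite /B; case: ifP => _;
      [exact: mA|exact: measurable0].
    apply: (@le_trans _ _ (leb R (\bigcup_i B i))).
      rewrite distribution_funE; apply: (le_measure_ae (gamma := gamma)).
      + exact: measurable_superlevel.
      + exact: bigcupT_measurable.
      + by move=> t [].
      + apply: filterS fa => t [fA fN] [_ /= lt].
        have [[i At]|Nt] := pselect (exists i, A i t).
          by exists i => //; rewrite /B -(fA i At) lt.
        move: lt; rewrite fN; first by rewrite normr0 ltNge (ltW l0).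
        by move=> i At; apply: Nt; exists i.
    apply: le_trans (generalized_Boole_inequality _ _ _) _;
      [exact: mB|exact: bigcupT_measurable|].
    apply: lee_nneseries => [i _ _|i _]; first exact: measure_ge0.
    by rewrite /B /d_; case: ifP => // _; rewrite measure0.
apply: lee_nneseries => [i _ _|i _].
  by apply: mule_ge0 => //; exact: dmod_ge0.
apply: lee_wpmul2l; first by rewrite lee_fin.
by apply: dmod_block_upper => //; rewrite normr_gt0.
Qed.

Lemma modular_steps_ge a f i : steps a f ->
  (phi `|a i|%R)%:E * weight_mass (gamma :=
    gamma) w (leb R (A i)) <= modular phi w f.
Proof.
move=> fa; rewrite modularE; apply: dmod_lower => // l /andP[l0 la].
rewrite distribution_funE; apply: (le_measure_ae (gamma := gamma)).
- exact: mA.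
- exact: measurable_superlevel.
- exact: AI.
- apply: filterS fa => t [fA _] At; split; first exact: AI At.
  by rewrite /= (fA i At).
Qed.

End Steps.

(** * Peaks that are small for one Orlicz function and large for all others *)

Section Blocks.
Context {R : realType} {gamma : \bar R}.
Variables (w phi : R -> R) (psi : nat -> R -> R).
Hypothesis gamma0 : (0 < gamma)%E.
Hypothesis wP : weight_function gamma w.
Hypothesis phiO : orlicz_function phi.
Hypothesis psiO : forall n, orlicz_function (psi n).
Hypothesis psiD : forall n, Delta_infty phi (psi n).
Local Notation W := (weight_mass (gamma := gamma) w).

(** The third condition bears on all but finitely many single peaks, so that
    it is inherited by every infinite set of peaks; the second one bounds the
    modular of the sum of all peaks at the scale [K], by [dmod_nneseries]. *)
Definition peaks (A : nat -> set (lebR R)) (u : nat -> R) : Prop :=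
  [/\ forall i, 0 < u i,
      forall K : R, 0 < K ->
        (\sum_(i <oo) (2 ^ i.+1)%:R%:E * ((phi (K * u i))%:E * W (leb R (A i)))
          < +oo)%E &
      forall n (b : R), 0 < b ->
        \forall i \near \oo, (i.+1%:R%:E <= (psi n (b * u i))%:E * W (leb R (A
          i)))%E].

(** The peak [i] is a bump of parameter [j = i.+1] standing at the left end
    of the dyadic interval [[del / 2 ^+ i.+1, del / 2 ^+ i)]. From [K <=
    i.+1] on, the terms of the series are at most [2 ^+ i.+1 / 4 ^+ i.+1]. *)
Lemma peaks_exist : exists (A : nat -> set (lebR R)) (u : nat -> R),
  [/\ forall i, measurable (A i), forall i, A i `<=` intvl gamma,
      forall i j t, A i t -> A j t -> i = j, forall i, (0 < leb R (A i))%E &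
      peaks A u].
Proof.
have [del [del0 delg]] : exists del : R, 0 < del /\ (del%:E <= gamma)%E.
  move: gamma0; case: gamma => [r||] //; first by rewrite lte_fin => r0;
    exists r.
  by move=> _; exists 1; rewrite leey.
pose p i : R := del / 2 ^+ i.
have p0 i : 0 < p i by rewrite divr_gt0// exprn_gt0.
have pS i : p i = p i.+1 + p i.+1.
  by rewrite /p exprS; field; rewrite expf_neq0.
have p_le i j : (i <= j)%N -> p j <= p i.
  by move=> ij; rewrite ler_pM2l// lef_pV2 ?posrE ?exprn_gt0// ler_eXn2l//
    ltr1n.
have /choice[m mP] i := bump_exists gamma0 wP phiO psiD (ltn0Sn i) (p0 i.+1).
have /choice[u uP] i := mP i.
have {mP uP} /choice[W0 P] i := uP i.
pose A i : set (lebR R) := `[p i.+1, p i.+1 + m i[%classic.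
have m0 i : 0 < m i by have [/andP[]] := P i.
have leA i : leb R (A i) = (m i)%:E.
  rewrite leb_lebesgue lebesgue_measure_itv/= lte_fin ltrDl m0.
  by rewrite -EFinB addrAC subrr add0r.
have Ap i t : A i t -> p i.+1 <= t < p i.
  rewrite /A /= in_itv/= => /andP[-> tm] /=; apply: lt_le_trans tm _.
  by rewrite [leRHS]pS lerD2l; have [/andP[]] := P i.
have W00 i : 0 < W0 i.
  have [_ _ WE _ _] := P i.
  by rewrite -lte_fin -WE; apply: (weight_mass_gt0 gamma0 wP); rewrite lte_fin.
exists A, u; split.
- by move=> i; apply: measurable_leb; exact: measurable_itv.
- move=> i t /Ap/andP[pt tp]; split; first exact: le_trans (ltW (p0 _)) pt.
  apply: lt_le_trans delg; rewrite lte_fin; apply: lt_le_trans tp _.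
  by have := p_le 0%N i (leq0n i); rewrite {2}/p expr0 divr1.
- move=> i j t /Ap/andP[it ti] /Ap/andP[jt tj]; apply/eqP; rewrite eqn_leq.
  apply/andP; split; rewrite leqNgt; apply/negP => ij.
    by have := p_le _ _ ij; apply/negP; rewrite -ltNge (le_lt_trans jt).
  by have := p_le _ _ ij; apply/negP; rewrite -ltNge (le_lt_trans it).
- by move=> i; rewrite leA lte_fin.
split.
- by move=> i; have [] := P i.
- move=> K K0; pose x i := ((2 ^ i.+1)%:R%:E * ((phi (K * u i))%:E * W (leb R
  (A i))))%E.
  rewrite -/(\sum_(i <oo) x i)%E.
  have x0 i : (0 <= x i)%E.
    rewrite /x leA; have [_ u0 -> _ _] := P i.
    rewrite -!EFinM lee_fin mulr_ge0// mulr_ge0 ?(ltW (W00 i))//.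
    by apply: (orlicz_ge0 phiO); rewrite mulr_ge0// ltW.
  pose k := (Num.truncn K).+1.
  rewrite (nneseries_split 0 k) => [|i _]; last exact: x0.
  rewrite add0n; apply: lte_add_pinfty.
    rewrite lte_sum_pinfty// => i _; rewrite /x leA.
    by have [_ _ -> _ _] := P i; rewrite -!EFinM ltry.
  apply: (@le_lt_trans _ _ 1%:E); last exact: ltry.
  rewrite eseries_cond; apply: le_trans (epsilon_trick0 (fun i =>
    true && (k <= i)%N) ler01).
  apply: lee_nneseries => [i _ _|i /= ki]; first exact: x0.
  rewrite /x leA; have [_ u0 -> h _] := P i; rewrite -!EFinM lee_fin.
  have Ki : K <= i.+1%:R.
    by apply/ltW; apply: lt_le_trans (truncnS_gt K) _;
      rewrite ler_nat (leq_trans ki).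
  have pK : phi (K * u i) <= phi (i.+1%:R * u i).
    by apply: (orlicz_le phiO); [rewrite mulr_ge0// ltW|rewrite ler_pM2r].
  have q0 : 0 < (2 ^ i.+1)%:R :> R by rewrite ltr0n expn_gt0.
  rewrite ler_pdivlMr//; apply: le_trans h.
  have -> : 4 ^+ i.+1 = (2 ^ i.+1)%:R * (2 ^ i.+1)%:R :> R.
    by rewrite -natrM -expnMn natrX.
  rewrite mulrC !mulrA ler_pM2r// -!mulrA ler_pM2l// ler_pM2l//.
- move=> n b b0; near=> i; rewrite leA; have [_ u0 -> _ h] := P i.
  rewrite -EFinM lee_fin; have ni : (n < i.+1)%N by near: i; exists n.
  apply: le_trans (h n ni) _; rewrite ler_pM2r//.
  apply: (orlicz_le (psiO n)); first by rewrite mulr_ge0// ltW.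
  rewrite ler_pM2r// ltW//; near: i.
  exact: (near_infty_natSinv_lt (PosNum b0)).
Unshelve. all: by end_near. Qed.

End Blocks.

(** * The closed subspace spanned by groups of peaks *)

Section Span.
Context {R : realType} {gamma : \bar R}.
Local Notation L := (L0 gamma).
Variables (w phi : R -> R) (psi : nat -> R -> R).
Hypothesis gamma0 : (0 < gamma)%E.
Hypothesis wP : weight_function gamma w.
Hypothesis phiO : orlicz_function phi.
Hypothesis psiO : forall n, orlicz_function (psi n).
Variables (A : nat -> set (lebR R)) (u : nat -> R).
Hypothesis mA : forall i, measurable (A i).
Hypothesis AI : forall i, A i `<=` intvl gamma.
Hypothesis tA : forall i j t, A i t -> A j t -> i = j.
Hypothesis A0 : forall i, (0 < leb R (A i))%E.
Hypothesis Au : peaks (gamma := gamma) w phi psi A u.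
Local Notation rho := (modular phi w).
Local Notation N := (luxemburg_norm phi w).
Implicit Types (a b : nat -> R) (f g : L).

(** The 2-adic valuation sorts the indices into infinitely many infinite
    groups; the peaks of one group share one coefficient. *)
Definition coordinate (i : nat) : nat := logn 2 i.

Lemma coordinate_infinite k n : exists2 i, (n <= i)%N & coordinate i = k.
Proof.
exists (2 ^ k * n.*2.+1)%N.
  apply: leq_trans (leq_pmull _ _); last by rewrite expn_gt0.
  by rewrite leqW// -addnn leq_addr.
by rewrite /coordinate lognM ?expn_gt0// pfactorK// logn_coprime ?addn0//
  coprime2n /= odd_double.
Qed.

Lemma peak_gt0 i : 0 < u i.
Proof. by case: Au. Qed.

Lemma peak_neq0 i : u i != 0.
Proof. by rewrite gt_eqF// peak_gt0. Qed.

(** [f] is the pointwise sum of the [a k * f_ k], where [f_ k] is the sum of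
    the peaks of the group [k]. *)
Definition combination a f : Prop :=
  steps A (fun i => a (coordinate i) * u i) f.

Lemma combination_exists a : exists f, combination a f.
Proof. exact: steps_exist. Qed.

Lemma combination0 : combination (fun=> 0) (0 : L).
Proof. by apply: eq_steps (@steps0 _ _ _) => i; rewrite mul0r. Qed.

Lemma combination_lin c a b f g : combination a f -> combination b g ->
  combination (fun k => c * a k + b k) (c *: f + g).
Proof.
by move=> fa gb; apply: eq_steps (steps_lin c fa gb) => i; rewrite mulrDl mulrA.
Qed.

Lemma combination_inj a b f : combination a f -> combination b f -> a =1 b.
Proof.
move=> fa fb k; have [i _ ik] := coordinate_infinite k 0.
by have := steps_inj mA AI A0 fa fb i; rewrite ik => /(mulIf (peak_neq0 i)).
Qed.

(** All the blocks [i] of one group yield the same limit of coefficients [b i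
    / u i]; [r] picks one block in each group. *)
Lemma combination_limit (y : nat ->
  L) f : (forall n, exists a, combination a (y n)) ->
  (\forall t \ae lebI gamma, y n t @[n --> \oo] --> f t) ->
  exists a, combination a f.
Proof.
move=> /choice[a ya] yf; have [b fb ab] := steps_limit mA AI A0 ya yf.
have alim i : a n (coordinate i) @[n --> \oo] --> b i / u i.
  have -> : (fun n => a n (coordinate i)) = (fun n =>
    a n (coordinate i) * u i / u i).
    by apply/funext => n; rewrite mulfK// peak_neq0.
  by apply: cvgMr_tmp; exact: ab.
have /choice[r rP] k : exists i, coordinate i = k.
  by have [i _ ik] := coordinate_infinite k 0; exists i.
exists (fun k => b (r k) / u (r k)); apply: eq_steps fb => i.
have := alim (r (coordinate i)); rewrite rP => /norm_cvg_unique/(_ (alim i)) ->.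
by rewrite divfK// peak_neq0.
Qed.

Lemma le_modular_scale (c d : R) f : `|c| <= `|d| ->
  (rho (c *: f) <= rho (d *: f))%E.
Proof.
move=> cd; apply: (le_modular wP phiO).
apply: filterS2 (L0_scaleE_ae c f) (L0_scaleE_ae d f) => t -> ->.
by rewrite !normrM ler_wpM2r.
Qed.

(** A bounded combination is dominated by a multiple of the sum of all peaks. *)
Lemma modular_combination_lty a f (C K : R) : combination a f ->
  (forall k, `|a k| <= C) -> 0 < K -> (rho (K *: f) < +oo)%E.
Proof.
move=> fa aC K0; have C1 : 0 < C + 1.
  by have := le_trans (normr_ge0 _) (aC 0%N) => C0; rewrite ltr_wpDl.
have [_ Afin _] := Au; have KC0 : 0 < K * (C + 1) by rewrite mulr_gt0.
have c0 i : 0 < K * (C + 1) * u i by rewrite mulr_gt0// peak_gt0.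
have [g gP] := @steps_exist R gamma A mA tA (fun i => K * (C + 1) * u i).
apply: (@le_lt_trans _ _ (rho g)).
  apply: (le_modular wP phiO).
  apply: filterS3 (L0_scaleE_ae K f) fa gP => t -> [fA fN] [gA gN].
  have [[i At]|Nt] := pselect (exists i, A i t); last first.
    by rewrite fN ?mulr0 ?normr0// => i At; apply: Nt; exists i.
  rewrite (fA i)// (gA i)// mulrA !normrM ler_wpM2r// ler_wpM2l//.
  by rewrite [leRHS]gtr0_norm// (le_trans (aC _))// lerDl.
apply: le_lt_trans (modular_steps_le mA wP phiO gP _) _.
  by move=> i; rewrite gt_eqF.
by under eq_eseriesr do rewrite gtr0_norm//; exact: Afin.
Qed.

(** A nonzero coefficient brings in infinitely many peaks. *)
Lemma combination_notin a f k n : combination a f -> a k != 0 ->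
  ~ orlicz_lorentz (psi n) w f.
Proof.
move=> fa ak [c c0 foo]; have [_ _ /(_ n (c * `|a k|)) big] := Au.
have {}big := big (mulr_gt0 c0 _); rewrite normr_gt0 in big;
  have [m _ mP] := big ak.
set x := modular _ _ _ in foo.
have x0 : (0 <= x)%E by exact: (modular_ge0 wP (psiO n)).
have [i mi ik] := coordinate_infinite k (maxn m (Num.truncn (fine x))).
have := mP i (leq_trans (leq_maxl _ _) mi).
have := modular_steps_ge mA AI wP (psiO n) i (steps_scale c fa).
rewrite ik !normrM (gtr0_norm c0) (gtr0_norm (peak_gt0 i)) mulrA -/x => h1 h2.
have := le_trans h2 h1; rewrite leNgt => /negP; apply.
rewrite -(@fineK _ x) ?ge0_fin_numE// lte_fin.
apply: lt_le_trans (truncnS_gt _) _; rewrite ler_nat ltnS.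
by rewrite (leq_trans (leq_maxr _ _) mi).
Qed.

Lemma combination_neq0 a f : combination a f -> f != 0 -> exists k, a k != 0.
Proof.
move=> fa f0; apply: contrapT => /forallNP h; move/eqP: f0; apply.
apply: (@steps_eq0 _ _ A); apply: eq_steps fa => i.
by have /negP := h (coordinate i); rewrite negbK => /eqP ->; rewrite mul0r.
Qed.

(** These are the order continuous elements of the Orlicz-Lorentz space,
    described by their modulars. *)
Definition finite_elements : set L :=
  [set f | forall K : R, 0 < K -> (rho (K *: f) < +oo)%E].

Definition combinations (X : set L) : set L :=
  [set f | (exists a, combination a f) /\ X f].

Lemma finite_elements_scale f (K : R) : finite_elements f ->
  (rho (K *: f) < +oo)%E.
Proof.
move=> fF; have K0 : 0 < `|K| + 1 by rewrite ltr_wpDl.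
by apply: le_lt_trans (fF _ K0); apply: le_modular_scale;
  rewrite (gtr0_norm K0) lerDl.
Qed.

Lemma finite_elements_add c f g : finite_elements f -> finite_elements g ->
  finite_elements (c *: f + g).
Proof.
move=> fF gF K K0; rewrite scalerDr scalerA; apply: (modular_add_lty wP phiO);
  by rewrite scalerA; exact: finite_elements_scale.
Qed.

Lemma orlicz_lorentz_add c f g : orlicz_lorentz phi w f ->
  orlicz_lorentz phi w g ->
  orlicz_lorentz phi w (c *: f + g).
Proof.
move=> [k1 k10 f1] [k2 k20 g2].
pose k := Order.min (k1 / (2 * (`|c| + 1))) (k2 / 2).
have c1 : 0 < 2 * (`|c| + 1) by rewrite mulr_gt0// ltr_wpDl.
have k0 : 0 < k by rewrite lt_min !divr_gt0.
have kk1 : k <= k1 / (2 * (`|c| + 1)) by rewrite ge_min lexx.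
have kk2 : k <= k2 / 2 by rewrite ge_min lexx orbT.
exists k; first exact: k0.
rewrite scalerDr scalerA; apply: (modular_add_lty wP phiO); rewrite scalerA.
- apply: le_lt_trans f1; apply: le_modular_scale.
  rewrite !normrM (@gtr0_norm _ 2)// (gtr0_norm k0) (gtr0_norm k10); move: kk1;
    rewrite ler_pdivlMr//.
  by move: k0; lra.
- apply: le_lt_trans g2; apply: le_modular_scale.
  by rewrite normrM !gtr0_norm// mulrC -ler_pdivlMr.
Qed.

Lemma combinations_submod (X : set L) : X 0 ->
  (forall c f g, X f -> X g -> X (c *: f + g)) ->
  submod_closed [in combinations X].
Proof.
move=> X0 Xlin; split.
  by rewrite inE; split => //; exists (fun=> 0); exact: combination0.
move=> c f g; rewrite !inE => -[[a fa] Xf] [[b gb] Xg]; split; last exact: Xlin.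
by exists (fun k => c * a k + b k); exact: combination_lin.
Qed.

Lemma combinations_closure (X Y : set L) f : norm_closure Y N (combinations X)
  f ->
  exists a, combination a f.
Proof.
move=> /(norm_closure_ae gamma0 wP phiO)[y My yf].
by apply: combination_limit yf => n; have [] := My n.
Qed.

(** In [K *: f = K *: y - K *: (y - f)], with [y] close to [f], the last term
    has modular at most 1 even after being doubled. *)
Lemma finite_elements_closure (X : set L) f : norm_closure X N finite_elements
  f ->
  finite_elements f.
Proof.
move=> [_ fM] K K0; have e0 : 0 < (2 * K)^-1 by rewrite invr_gt0 mulr_gt0.
have [y Fy /ereal_inf_lt[_ [e [e1 he] <-]]] := fM _ e0; rewrite lte_fin => ee.
have -> : K *: f = K *: y + - K *: (y - f).
  by rewrite scaleNr -scalerN opprB -scalerDr addrC subrK.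
apply: (modular_add_lty wP phiO); rewrite scalerA;
  first exact: finite_elements_scale.
apply: le_lt_trans (ltry 1); apply: le_trans he; apply: le_modular_scale.
rewrite normrM normrN !gtr0_norm// ?invr_gt0//.
by rewrite -[leLHS]invrK lef_pV2 ?posrE// ?invr_gt0 ?mulr_gt0// ltW.
Qed.

Lemma finite_elements_order_continuous f : finite_elements f ->
  order_continuous phi w f.
Proof. exact: order_continuous_of_modular. Qed.

Lemma finite_elements_lorentz f : finite_elements f -> orlicz_lorentz phi w f.
Proof. by move=> fF; exists 1; [exact: ltr01|exact: (fF _ ltr01)]. Qed.

Lemma finite_elements0 : finite_elements 0.
Proof.
move=> K; apply: (modular_combination_lty (C := 1) combination0) => k.
by rewrite normr0.
Qed.

(** The geometric sequences [k |-> z ^+ k] with [0 < z < 1] are linearly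
    independent: a linear relation between them, tested against a polynomial,
    is a relation between the values of that polynomial, which may be chosen
    to vanish at all the ratios but one. *)
Lemma geometric_family : exists v : R -> L,
  [/\ injective v, forall x, (exists a, combination a (v x)) /\ finite_elements
    (v x) &
      lin_independent (range v)].
Proof.
(* An injection of the reals into the unit interval. *)
pose s (x : R) := (1 + expR x)^-1.
have s0 x : 0 < s x by rewrite invr_gt0 addr_gt0// expR_gt0.
have s1 x : s x <= 1 by rewrite invf_le1 ?lerDl ?expR_ge0// addr_gt0// expR_gt0.
have sI : injective s by move=> x y /invr_inj/addrI/expR_inj.
have /choice[v vP] x := combination_exists (fun k => s x ^+ k).
have vI : injective v.
  move=> x y xy; apply: sI; have := vP x; rewrite xy => vy.
  by have := combination_inj vy (vP y) 1%N; rewrite !expr1.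
exists v; split => //.
  move=> x; split; first by exists (fun k => s x ^+ k).
  move=> K; apply: (modular_combination_lty (C := 1) (vP x)) => k.
  by rewrite normrX (gtr0_norm (s0 x)); apply: exprn_ile1; rewrite ?s1 ?ltW.
move=> q c uq qv q0 g gq.
have /choice[e eP] (h : L) : exists x, h \in q -> v x = h.
  have [hq|hq] := boolP (h \in q); last by exists 0.
  by have [x _ xh] := qv _ hq; exists x.
pose z h := s (e h).
have rel k : \sum_(h <- q) c h * z h ^+ k = 0.
  have : combination (fun k => \sum_(h <- q) c h * z h ^+ k) (\sum_(h <- q) c h
    *: h).
    elim: q {uq qv q0 gq} eP => [|h r IH] eP.
      by rewrite big_nil; apply: eq_steps combination0 => i; rewrite big_nil.
    rewrite big_cons; apply: (@eq_steps _ _ _ (fun i =>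
        (c h * z h ^+ coordinate i + \sum_(h' <- r) c h' * z h' ^+ coordinate
          i) * u i)).
      by move=> i; rewrite big_cons.
    apply: combination_lin (IH _); last by move=> h' hr; apply: eP;
      rewrite inE hr orbT.
    by have := vP (e h); rewrite eP ?mem_head.
  by rewrite q0 => /combination_inj/(_ combination0).
have relp (p : {poly R}) : \sum_(h <- q) c h * p.[z h] = 0.
  under eq_bigr do rewrite horner_coef mulr_sumr.
  rewrite exchange_big big1//= => k _.
  under eq_bigr do rewrite mulrCA.
  by rewrite -mulr_sumr rel mulr0.
pose p := \prod_(h <- rem g q) ('X - (z h)%:P).
have := relp p; rewrite (big_rem g)//= big_seq big1 => [|h hq]; last first.
  by rewrite /p horner_prod (big_rem h)//= hornerXsubC subrr mul0r mulr0.
rewrite addr0 => /eqP; rewrite mulf_eq0 => /orP[/eqP//|].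
rewrite /p horner_prod prodf_seq_eq0 => /hasP[h];
  rewrite mem_rem_uniq// inE => /andP[hg hq].
rewrite /= hornerXsubC subr_eq0 => /eqP/sI eE.
by move: hg; rewrite -(eP h hq) -(eP g gq) eE eqxx.
Qed.

End Span.

(** * The theorem *)

Lemma hamel_basis_continuum {R : realType} {gamma : \bar R} (v : R -> L0 gamma)
    (V : set (L0 gamma)) :
  injective v -> lin_independent (range v) -> range v `<=` V ->
  exists2 B, hamel_basis V B & (B #= [set: R])%card.
Proof.
move=> vI indv vV; have [B BV vB] := hamel_basis_extension vV indv.
exists B => //; apply/card_eqPle; split; first exact: card_L0_le.
have : (range v #= [set: R])%card by apply: inj_card_eq => x y _ _; exact: vI.
by move=> /card_eqPle[_ /card_le_trans]; apply; exact: subset_card_le.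
Qed.

Theorem theorem4p1 (R : realType) (gamma : \bar R) (w : R -> R)
    (phi : R -> R) (phin : nat -> R -> R) :
  (0 < gamma)%E ->
  weight_function gamma w ->
  orlicz_function phi ->
  (forall n, orlicz_function (phin n)) ->
  (forall n, Delta_infty phi (phin n)) ->
  let Lambda psi : set (L0 gamma) := orlicz_lorentz psi w in
  let Lambda_a : set (L0 gamma) := order_continuous phi w in
  spaceable Lambda_a (luxemburg_norm phi w) [set: R]
    (Lambda_a `\` \bigcup_n Lambda (phin n)) /\
  ((gamma = +oo%E -> delta2 phi) ->
   ((gamma < +oo)%E -> delta2_infty phi) ->
   maximal_spaceable (Lambda phi) (luxemburg_norm phi w)
     (Lambda phi `\` \bigcup_n Lambda (phin n))).
Proof.
move=> gamma0 wP phiO phinO phinD Lambda Lambda_a.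
have [A [u [mA AI tA A0 Au]]] := peaks_exist gamma0 wP phiO phinO phinD.
have [v [vI vP indv]] := geometric_family wP phiO mA AI tA A0 Au.
pose M X := combinations (gamma := gamma) A u X.
have avoid X : M X `\` [set 0] `<=` ~` \bigcup_n Lambda (phin n).
  move=> f [[[a fa] _] /eqP/(combination_neq0 fa)[k ak]] [n _].
  exact: (combination_notin wP phinO mA AI Au fa ak).
have sub X : M X `<=` (X `\` \bigcup_n Lambda (phin n)) `|` [set 0].
  move=> f Mf; have [->|f0] := pselect (f = 0); [by right|left; split].
    by case: Mf.
  by apply: (avoid X); split.
pose F := finite_elements (gamma := gamma) w phi.
have MFv : range v `<=` M F by move=> _ [x _ <-]; exact: vP.
have Flor f : F f -> Lambda phi f by exact: finite_elements_lorentz.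
split.
  exists (M F); split.
  - split.
    + by move=> f [_ Ff]; exact: (finite_elements_order_continuous gamma0 wP
      phiO).
    + apply: combinations_submod; first exact: (finite_elements0 wP phiO mA tA
      Au).
      by move=> c f g; exact: (finite_elements_add wP phiO).
    + move=> f fcl; split; first exact: (combinations_closure gamma0 wP phiO mA
      AI A0 Au fcl).
      apply: (finite_elements_closure wP phiO (X := Lambda_a)).
      have [Xf fM] := fcl; split => // e e0.
      by have [y [_ Fy] ye] := fM e e0; exists y.
  - exact: hamel_basis_continuum MFv.
  - move=> f /sub[[Ff Nf]|f0]; [left; split|by right].
      exact: (finite_elements_order_continuous gamma0 wP phiO).
    exact: Nf.
move=> _ _.
have [B Bbasis Bcard] := hamel_basis_continuum vI indv
  (fun f rf => Flor f (MFv f rf).2 : Lambda phi f).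
exists B => //; exists (M (Lambda phi)); split.
- split.
  + by move=> f [].
  + apply: combinations_submod; first exact/Flor/(finite_elements0 wP phiO mA
    tA Au).
    by move=> c f g; exact: (orlicz_lorentz_add wP phiO).
  + move=> f fcl; split; last by case: fcl.
    exact: (combinations_closure gamma0 wP phiO mA AI A0 Au fcl).
- have [f /MFv[fa Ff]|B' B'basis B'card] :=
  @hamel_basis_continuum _ _ v (M (Lambda phi)) vI indv.
    by split => //; exact: Flor.
  exists B' => //; apply: card_eq_trans B'card _.
  by rewrite card_eq_sym.
- exact: sub.
Qed.
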